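(* Let $\mathfrak C$ be a finitely aligned, left cancellative, countable small category and $\mathfrak S$ a Garside family in $\mathfrak C$ with $\mathfrak S \cap \mathfrak C^* = \emptyset$ which is $=^*$-transverse and locally bounded. Let $I_l\ltimes\Omega$ be the groupoid model for $C^*_\lambda(\mathfrak C)$. Then there is a one-to-one correspondence between closed invariant subspaces of $I_l\ltimes\Omega$ (that is, closed invariant subspaces of its unit space $\Omega$) and admissible, $H$-invariant, $\max_{\preceq}^{\infty}$-closed pairs $(\mathfrak T,\mathfrak D)$ with $\mathfrak T\subseteq\mathfrak S$ and $\mathfrak D\subseteq\mathfrak C^0$.
   Context: **Categories.** $\mathfrak C$ denotes the set of morphisms of a small category, $\mathfrak C^0\subseteq\mathfrak C$ the set of identity morphisms (identified with the objects), $\mathfrak d,\mathfrak t:\mathfrak C\to\mathfrak C^0$ the domain and target maps; $cd$ is defined iff $\mathfrak d(c)=\mathfrak t(d)$. $\mathfrak C$ is left cancellative if $cx=cy$ implies $x=y$. $\mathfrak C^*$ is the set of invertible elements. For $c\in\mathfrak C$ and $S\subseteq\mathfrak C$, $cS=\{cs: s\in S,\ \mathfrak t(s)=\mathfrak d(c)\}$. $\mathfrak C$ is finitely aligned if for all $a,b\in\mathfrak C$ there is a finite $F\subseteq\mathfrak C$ with $a\mathfrak C\cap b\mathfrak C=\bigcup_{c\in F}c\mathfrak C$. **Groupoid.** Each $c\in\mathfrak C$ gives the partial bijection $\mathfrak d(c)\mathfrak C\to c\mathfrak C$, $x\mapsto cx$; $I_l$ is the smallest semigroup of partial bijections of $\mathfrak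 C$ containing these and closed under inverses; $\mathcal J=\{\mathrm{dom}(s):s\in I_l\}$ is its semilattice of idempotents (product = intersection). $\widehat{\mathcal J}$ is the space of non-zero multiplicative maps $\chi:\mathcal J\to\{0,1\}$ with $\chi(\emptyset)=0$ if $\emptyset\in\mathcal J$ (topology of pointwise convergence). $\Omega\subseteq\widehat{\mathcal J}$ is the subspace of those $\chi$ such that whenever $e=\bigcup_{i=1}^n f_i$ with $e,f_1,\dots,f_n\in\mathcal J$ and $\chi(e)=1$, then $\chi(f_i)=1$ for some $i$. $s\in I_l$ acts by $\{\chi\in\Omega:\chi(s^{-1}s)=1\}\to\{\chi\in\Omega:\chi(ss^{-1})=1\}$, $\chi\mapsto s.\chi=\chi(s^{-1}\,\cdot\, s)$, and $I_l\ltimes\Omega$ is the corresponding transformation groupoid (classes $[s,\chi]$ with $\chi(s^{-1}s)=1$; $[s,\chi]=[t,\chi]$ iff $se=te$ for some $e\in\mathcal J$ with $\chi(e)=1$; source $\chi$, range $s.\chi$). A subset $X\subseteq\Omega$ is invariant iff $s.\chi\in X$ whenever $s\in I_l$, $\chi\in X$ and $\chi(s^{-1}s)=1$. $C^*_\lambda(\mathfrak C)\subseteq\mathcal L(\ell^2\mathfrak C)$ is the C*-algebra generated by the partial isometries $\lambda_c$ ($c\in\mathfrak C$), where $\lambda_c\delta_x=\delta_{cx}$ if $\mathfrak t(x)=\mathfrak d(c)$ and $\lambda_c\delta_x=0$ otherwise. **Garside families.** $a\preceq b$ means $b\in a\mathfrak C$; $a\prec b$ means $b\mathfrak C\subsetneq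 a\mathfrak C$; $a=^*b$ means $a\in b\mathfrak C^*$; $a$ is a right divisor of $b$ if $b\in\mathfrak Ca$. $\mathfrak S$ is $=^*$-transverse if $s_1,s_2\in\mathfrak S$, $s_1=^*s_2$ imply $s_1=s_2$. $\mathfrak S$ is locally bounded if for every $\mathfrak v\in\mathfrak C^0$ there is no infinite sequence $s_1\prec s_2\prec\cdots$ in $\mathfrak v\mathfrak S$. A path is a finite or infinite sequence $s_1s_2\cdots$ in $\mathfrak C$ with $\mathfrak d(s_k)=\mathfrak t(s_{k+1})$ for all $k$. Put $\mathfrak S^\sharp=\mathfrak S\mathfrak C^*\cup\mathfrak C^*$. $\mathfrak S$ is a Garside family if: (1) it is closed under right comultiples (for $r,s\in\mathfrak S$, $a\in\mathfrak C$ with $r\preceq a$, $s\preceq a$ there is $t\in\mathfrak S$ with $r\preceq t$, $s\preceq t$, $t\preceq a$); (2) $\mathfrak S\cup\mathfrak C^*$ generates $\mathfrak C$; (3) $\mathfrak S^\sharp$ is closed under right divisors; (4) every $a\in\mathfrak C$ equals $s_1\cdots s_l$ for some normal path $s_1\cdots s_l$ in $\mathfrak S^\sharp$, where a path $s_1s_2\cdots$ in $\mathfrak S^\sharp$ is normal if for all $k$ (for which $s_{k+1}$ is defined) and all $r\in\mathfrak S$, $r\preceq s_ks_{k+1}$ implies $r\preceq s_k$. For $a\in\mathfrak C\setminus\mathfrak C^*$, $H(a)$ denotes the unique $s\in\mathfrak S$ with $s\preceq a$ such that every $r\in\mathfrak S$ with $r\preceq a$ satisfies $r\preceq s$. **Limits.**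 For a sequence $(s_i)$ in $\mathfrak S$ and $s\in\mathfrak S\cup\mathfrak C^0$, write $\lim_i s_i=s$ if $s$ is maximal with respect to $\preceq$ among $\{r\in\mathfrak S\cup\mathfrak C^0: r\preceq s_i\text{ for almost all }i\}$. **Conditions on pairs** $(\mathfrak T,\mathfrak D)$ with $\mathfrak T\subseteq\mathfrak S$, $\mathfrak D\subseteq\mathfrak C^0$: - admissible: for every $t\in\mathfrak T$, there is $t'\in\mathfrak T$ such that $tt'$ is normal, or $\mathfrak d(t)\in\mathfrak D$; - $H$-invariant: for all $a\in\mathfrak C\setminus\mathfrak C^*$ and $x\in\mathfrak T\cup\mathfrak D$ with $\mathfrak d(a)=\mathfrak t(x)$, $H(ax)$ lies in $\mathfrak T$; - $\max_\preceq^\infty$-closed: for every sequence $(t_i)$ in $\mathfrak T$, if $\lim_i t_i$ exists in $\mathfrak S$, then $\lim_i t_i\in\mathfrak T\cup\mathfrak D$.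
   Formalization: The limit in max-closedness must be maximal along every subsequence (not just for the sequence itself) and may lie in C^0 as well as in S; and D is additionally required to be closed under isomorphism of objects. Without these changes the claim is false. *)

(* Defs.v *)
(* MathComp / MathComp-Analysis *)
From mathcomp Require Import all_boot all_order.
From mathcomp Require Import all_classical.
From mathcomp Require Import topology.

Set Implicit Arguments.
Unset Strict Implicit.
Unset Printing Implicit Defensive.

Local Open Scope classical_set_scope.

(* Arrows-only presentation: a category is its set of morphisms, an object is
   its identity morphism.  [cmul] is total, but [cmul a b] is meaningful only
   when [dom a = tgt b], and it is never used outside of that case. *)
Record smallCategory := SmallCategory {
  mor :> Type;
  dom : mor -> mor;
  tgt : mor -> mor;
  cmul : mor -> mor -> mor;
  dom_dom : forall c, dom (dom c) = dom c;
  tgt_dom : forall c, tgt (dom c) = dom c;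
  dom_tgt : forall c, dom (tgt c) = tgt c;
  tgt_tgt : forall c, tgt (tgt c) = tgt c;
  dom_mul : forall a b, dom a = tgt b -> dom (cmul a b) = dom b;
  tgt_mul : forall a b, dom a = tgt b -> tgt (cmul a b) = tgt a;
  mul_assoc : forall a b c, dom a = tgt b -> dom b = tgt c ->
    cmul a (cmul b c) = cmul (cmul a b) c;
  mul_tgt : forall c, cmul (tgt c) c = c;
  mul_dom : forall c, cmul c (dom c) = c
}.

Section Categories.
Variable C : smallCategory.
Implicit Types (a b c r s t u v x y : C) (A S T D : set C).

Definition composable a b : Prop := dom a = tgt b.

Definition objects : set C := range (@dom C).

Definition units : set C :=
  [set u | exists v, [/\ composable u v, composable v u,
                         cmul u v = tgt u & cmul v u = dom u]].

Definition left_cancellative : Prop :=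
  forall c x y, composable c x -> composable c y -> cmul c x = cmul c y -> x = y.

(* [lmulset c A] is cA and [rmulset A c] is Ac. *)
Definition lmulset c A : set C := cmul c @` [set x | A x /\ composable c x].
Definition rmulset A c : set C := (fun x => cmul x c) @` [set x | A x /\ composable x c].

Definition finitely_aligned : Prop :=
  forall a b, exists2 F : set C, finite_set F &
    lmulset a setT `&` lmulset b setT = \bigcup_(c in F) lmulset c setT.

Definition prec a b : Prop := lmulset a setT b.
Definition sprec a b : Prop := lmulset b setT `<` lmulset a setT.
Definition eqstar a b : Prop := lmulset b units a.
Definition rdivides a b : Prop := rmulset setT a b.

(** * The unit space of the groupoid *)

(* Partial bijections are represented by their graphs, and [s \; t] is the
   composite "t, then s". *)
Definition translation c : set (C * C) :=
  [set xy | composable c xy.1 /\ xy.2 = cmul c xy.1].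

Inductive left_inverse_hull : set (C * C) -> Prop :=
| hull_translation c : left_inverse_hull (translation c)
| hull_inv (s : set (C * C)) : left_inverse_hull s -> left_inverse_hull (s^-1)%relation
| hull_comp (s t : set (C * C)) : left_inverse_hull s -> left_inverse_hull t ->
    left_inverse_hull (s \; t)%relation.

Definition constructible : set (set C) :=
  [set e | exists2 s : set (C * C), left_inverse_hull s & e = s.`1].

Definition Il := {s : set (C * C) | left_inverse_hull s}.
Definition J := {e : set C | constructible e}.

Definition Il_dom (s : Il) : J :=
  exist _ ((sval s).`1) (ex_intro2 _ _ (sval s) (svalP s) erefl).

Lemma constructible_pullback (s : Il) (e : J) :
  constructible [set x | exists2 y, sval s (x, y) & sval e y].
Proof.
case: s => s hs; case: e => e /= [t ht eE]; subst e.
exists (t \; s)%relation; first exact: hull_comp.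
apply/seteqP; split=> x /=; first by move=> [y sxy [z tyz]]; exists z, y.
by move=> [z [y sxy tyz]]; exists y => //; exists z.
Qed.

(* The domain of the idempotent s^-1 e s, where e stands for the identity
   map of the set e. *)
Definition pullback (s : Il) (e : J) : J := exist _ _ (constructible_pullback s e).

(* J is closed under intersection, so that the third clause below is
   multiplicativity. *)
Definition spectrum : set {ptws J -> bool} :=
  [set chi : {ptws J -> bool} | [/\ exists e, chi e,
                 forall e : J, sval e = set0 -> chi e = false &
                 forall e f g : J, sval g = sval e `&` sval f ->
                   chi g = chi e && chi f]].

Definition Omega : set {ptws J -> bool} :=
  [set chi : {ptws J -> bool} | spectrum chi /\
     forall (e : J) (n : nat) (f : 'I_n -> J),
       sval e = \bigcup_i sval (f i) -> chi e -> exists i, chi (f i)].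

(* s.chi, for chi with [chi (Il_dom s)] *)
Definition act (s : Il) (chi : {ptws J -> bool}) : {ptws J -> bool} :=
  fun e => chi (pullback s e).

Definition act_invariant (X : set {ptws J -> bool}) : Prop :=
  forall (s : Il) chi, X chi -> chi (Il_dom s) -> X (act s chi).

(* For X contained in Omega, being closed in [subspace Omega] means being
   closed in the relative topology. *)
Definition closed_invariant : set (set {ptws J -> bool}) :=
  [set X | [/\ X `<=` Omega, closed (X : set (subspace Omega)) & act_invariant X]].

(** * Garside families *)

Definition eqstar_transverse S : Prop :=
  forall s1 s2, S s1 -> S s2 -> eqstar s1 s2 -> s1 = s2.

Definition locally_bounded S : Prop :=
  forall v, objects v ->
    ~ exists s : nat -> C,
        forall n, lmulset v S (s n) /\ sprec (s n) (s n.+1).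

Definition sharp S : set C :=
  [set c | (exists2 s, S s & eqstar c s) \/ units c].

Definition right_comultiple_closed S : Prop :=
  forall r s a, S r -> S s -> prec r a -> prec s a ->
    exists t, [/\ S t, prec r t, prec s t & prec t a].

(* [x] and [p] encode the nonempty finite sequence [x :: p]. *)
Definition is_path x (p : seq C) : Prop := path (fun a b => `[<composable a b>]) x p.

Definition path_prod x (p : seq C) : C := foldl (@cmul C) x p.

Definition generates A : Prop :=
  forall a, exists x (p : seq C),
    [/\ all (fun c => `[<A c>]) (x :: p), is_path x p & a = path_prod x p].

Definition right_divisor_closed A : Prop :=
  forall a b, A b -> rdivides a b -> A a.

Definition normal_path S x (p : seq C) : Prop :=
  [/\ all (fun c => `[<sharp S c>]) (x :: p), is_path x p &
      path (fun a b => `[<forall r, S r -> prec r (cmul a b) -> prec r a>]) x p].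

Definition garside_family S : Prop :=
  [/\ right_comultiple_closed S,
      generates (S `|` units),
      right_divisor_closed (sharp S) &
      forall a, exists x (p : seq C), normal_path S x p /\ a = path_prod x p].

(* [s] is H(a); it is unique if S is transverse. *)
Definition is_head S a s : Prop :=
  [/\ S s, prec s a & forall r, S r -> prec r a -> prec r s].

(** * Pairs *)

Definition eventual_divisors S (u : nat -> C) : set C :=
  [set r | (S `|` objects) r /\ \forall i \near \oo, prec r (u i)].

Definition max_eventual_divisor S (u : nat -> C) s : Prop :=
  eventual_divisors S u s /\
  forall r, eventual_divisors S u r -> ~ sprec s r.

(* Maximality is required along every subsequence, as befits a limit.  For the
   sequence itself it is too weak: in the free monoid on a, b the identity is
   the greatest eventual divisor of a, b, a, b, ..., which has the constant
   subsequences a, a, ... and b, b, ... *)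
Definition is_limit S (u : nat -> C) s : Prop :=
  forall k : nat -> nat, {homo k : m n / (m < n)%N} ->
    max_eventual_divisor S (u \o k) s.

Definition admissible S T D : Prop :=
  forall t, T t -> (exists2 t', T t' & normal_path S t [:: t']) \/ D (dom t).

Definition H_invariant S T D : Prop :=
  forall a x, ~ units a -> (T `|` D) x -> composable a x ->
    exists2 s, is_head S (cmul a x) s & T s.

(* The counterpart of H-invariance for invertible a, which H-invariance does
   not cover: isomorphic objects v, w define the same orbit in Omega, so the
   objects in D can only be determined up to isomorphism. *)
Definition iso_closed D : Prop :=
  forall u, units u -> D (dom u) -> D (tgt u).

(* The limit may be an object as well as an element of S. *)
Definition max_closed S T D : Prop :=
  forall (u : nat -> C) s, (forall i, T (u i)) -> is_limit S u s -> (T `|` D) s.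

Definition garside_pair S : set (set C * set C) :=
  [set TD | [/\ TD.1 `<=` S, TD.2 `<=` objects & iso_closed TD.2] /\
            [/\ admissible S TD.1 TD.2, H_invariant S TD.1 TD.2 &
                max_closed S TD.1 TD.2]].

End Categories.

(* Main.v *)
Require Import Defs.
From mathcomp Require Import all_boot all_order.
From mathcomp Require Import all_classical.
From mathcomp Require Import topology.

(* Finite alignment makes every constructible set a finite union of principal
   right ideals cC, so a character chi in Omega is the same as a filter F for
   divisibility: chi(cC) = 1 iff c is in F.  The translation by c acts by
   F |-> cF and its inverse by F |-> c^-1 F.  By local boundedness and closure
   under right comultiples, F meets S in a set with a greatest element, the head
   of F, unless F consists of the units at one object v, which is then taken as
   the head.

   An invariant closed X is sent to the pair (T, D) of the heads in S and the
   heads in C^0 of the filters in X; conversely (T, D) is sent to the set of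
   filters F such that c^-1 F has its head in T or D for every c in F.  The
   H-law H(ab) = H(a H(b)) turns invariance of X into H-invariance of T.
   Admissibility lets one extend any t in T to a greedy, possibly eventually
   constant, path in T and D, whose prefixes form a filter with head t.  Finally,
   a filter all of whose tails c^-1 F have heads occurring in X is a limit of
   filters in X: prepending heads one at a time gives members of X agreeing with
   F on words of any given length in S and the units. *)

Set Implicit Arguments.
Unset Strict Implicit.
Unset Printing Implicit Defensive.

Local Open Scope classical_set_scope.

(** * Divisibility and Garside families *)

Section Divisibility.
Variable C : smallCategory.
Implicit Types (a b c r s t u v x y z : C).

Lemma precP a b : prec a b <-> exists2 x, composable a x & b = cmul a x.
Proof.
by split=> [[x [_ ax] <-]|[x ax ->]]; [exists x | exists x].
Qed.

Lemma composable_dom a : composable a (dom a).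
Proof. by rewrite /composable tgt_dom. Qed.

Lemma composable_tgt a : composable (tgt a) a.
Proof. by rewrite /composable dom_tgt. Qed.

Lemma prec_refl a : prec a a.
Proof. by apply/precP; exists (dom a); rewrite ?mul_dom; first exact: composable_dom. Qed.

Lemma prec_mulr a x : composable a x -> prec a (cmul a x).
Proof. by move=> ax; apply/precP; exists x. Qed.

Lemma prec_trans b a c : prec a b -> prec b c -> prec a c.
Proof.
move=> /precP[x ax ->] /precP[y]; rewrite /composable dom_mul // => xy ->.
apply/precP; exists (cmul x y); last by rewrite mul_assoc.
by rewrite /composable tgt_mul.
Qed.

Lemma prec_tgt a b : prec a b -> tgt a = tgt b.
Proof. by move=> /precP[x ax ->]; rewrite tgt_mul. Qed.

Lemma prec_mull c a b : composable c a -> prec a b -> prec (cmul c a) (cmul c b).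
Proof.
move=> ca /precP[x ax ->]; rewrite mul_assoc //.
by apply: prec_mulr; rewrite /composable dom_mul.
Qed.

Lemma composable_prec c a b : prec a b -> composable c a <-> composable c b.
Proof. by rewrite /composable => /prec_tgt ->. Qed.

Lemma objectP v : objects v <-> tgt v = v.
Proof.
split=> [[c _ <-]|v_tgt]; first by rewrite tgt_dom.
by exists v => //; rewrite -v_tgt dom_tgt.
Qed.

Lemma dom_object v : objects v -> dom v = v.
Proof. by move=> [c _ <-]; rewrite dom_dom. Qed.

Lemma objects_dom a : objects (dom a). Proof. by exists a. Qed.

Lemma objects_tgt a : objects (tgt a).
Proof. by apply/objectP; rewrite tgt_tgt. Qed.

Lemma prec_object v a : objects v -> prec v a <-> tgt a = v.
Proof.
move=> /objectP vE; split=> [/prec_tgt|<-]; first by rewrite vE.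
by apply/precP; exists a; rewrite ?mul_tgt//; exact: composable_tgt.
Qed.

Lemma prec_tgtl a : prec (tgt a) a.
Proof. by apply/(prec_object _ (objects_tgt a)). Qed.

Lemma sprecP a b : sprec a b <-> prec a b /\ ~ prec b a.
Proof.
split=> [[ba ab]|[ab ba]].
  split=> [|ab']; first by apply: ba; exact: prec_refl.
  by apply: ab => x; exact: prec_trans.
by split=> [x|ab']; [exact: prec_trans | apply: ba; apply: ab'; exact: prec_refl].
Qed.

Hypothesis C_lcancel : left_cancellative C.

Lemma prec_cancel c a b : composable c a -> composable c b ->
  prec (cmul c a) (cmul c b) -> prec a b.
Proof.
move=> ca cb /precP[x]; rewrite /composable dom_mul // => ax.
rewrite -mul_assoc // => /C_lcancel E.
by apply/precP; exists x => //; apply: E => //; rewrite /composable tgt_mul.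
Qed.

(** A right inverse v of u suffices: u (v u) = u, so left cancellation gives v u = [dom u]. *)
Lemma unitP u : units u <-> prec u (tgt u).
Proof.
split=> [[v [uv _ <- _]]|/precP[v uv uvE]]; first exact: prec_mulr.
have vu : composable v u by rewrite /composable -(dom_mul uv) -uvE dom_tgt.
exists v; split => //; apply: (C_lcancel (c := u)).
- by rewrite /composable tgt_mul.
- exact: composable_dom.
- by rewrite mul_assoc // -uvE mul_tgt mul_dom.
Qed.

Lemma unit_object v : objects v -> units v.
Proof. by move=> /objectP vE; apply/unitP; rewrite vE; exact: prec_refl. Qed.

Lemma unit_prec c u : units u -> prec c u -> units c.
Proof.
move=> /unitP u1 cu; apply/unitP; rewrite (prec_tgt cu).
exact: prec_trans u1.
Qed.

Lemma prec_unit u b : units u -> tgt u = tgt b -> prec u b.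
Proof. by move=> /unitP u1 E; apply: prec_trans u1 _; rewrite E; exact: prec_tgtl. Qed.

Lemma unit_inv u : units u -> exists v, [/\ units v, composable u v, composable v u,
  cmul u v = tgt u & cmul v u = dom u].
Proof.
move=> [v [uv vu uvE vuE]]; exists v; split=> //.
exists u; split=> //; first by rewrite vuE.
by rewrite uvE -(dom_mul uv) uvE dom_tgt.
Qed.

Lemma unit_mul u v : units u -> units v -> composable u v -> units (cmul u v).
Proof.
move=> u1 /unitP v1 uv; apply: unit_prec u1 _.
by rewrite -{2}(mul_dom u) uv; exact: prec_mull.
Qed.

Lemma eqstarP a b : eqstar a b <-> prec a b /\ prec b a.
Proof.
split=> [[u [/unitP u1 bu] <-]|[ab /precP[u bu aE]]].
  split; last exact: prec_mulr.
  by rewrite -{2}(mul_dom b) bu; exact: prec_mull.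
exists u => //; split=> //; apply/unitP.
apply: (@prec_cancel b) => //; first by rewrite /composable tgt_tgt.
by rewrite -aE -bu mul_dom.
Qed.

End Divisibility.

(** * The H-law and words over a Garside family *)

Section Garside.
Variables (C : smallCategory) (S : set C).
Hypothesis C_lcancel : left_cancellative C.
Hypothesis S_garside : garside_family S.
Hypothesis S_nonunit : S `&` @units C = set0.
Implicit Types (a b c r s t u v x y z : C).

Lemma nonunit s : S s -> ~ units s.
Proof. by move=> Ss us; have : (S `&` @units C) s by []; rewrite S_nonunit. Qed.

Lemma nonobject s : S s -> ~ objects s.
Proof. by move=> Ss /(unit_object C_lcancel); exact: nonunit. Qed.

Lemma generates_ind (P : C -> Prop) :
  (forall s, (S `|` @units C) s -> P s) ->
  (forall a b, P a -> P b -> composable a b -> P (cmul a b)) ->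
  forall a, P a.
Proof.
move=> P1 PM a; case: S_garside => _ /(_ a)[x [p [+ + ->]]] _ _.
rewrite /path_prod /is_path /= => /andP[/asboolP /P1 Px].
elim: p x Px => [//|s p IHp] x Px /= /andP[/asboolP Ss Sp] /andP[/asboolP xs sp].
have Pxs : P (cmul x s) by apply: PM => //; exact: P1.
apply: (IHp _ Pxs Sp).
by case: (p) sp => //= s' p' /andP[ss' ->]; rewrite /composable dom_mul // ss'.
Qed.

Lemma sharp_rdivisor a b : composable a b -> sharp S (cmul a b) -> sharp S b.
Proof.
move=> ab Sab; case: S_garside => _ _ + _; apply; first exact: Sab.
by exists a.
Qed.

Lemma sharp_repr a : sharp S a ->
  exists s, [/\ (S `|` @objects C) s, prec s a & prec a s].
Proof.
move=> [[s Ss /(eqstarP C_lcancel)[as_ sa]]|/(unitP C_lcancel) ua].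
  by exists s; split=> //; left.
exists (tgt a); split=> //; first by right; exact: objects_tgt.
exact: prec_tgtl.
Qed.

Lemma sub_S_units r : (S `|` @objects C) r -> (S `|` @units C) r.
Proof. by case=> [?|/(unit_object C_lcancel)]; [left | right]. Qed.

(* The H-law: H(ab) = H(a H(b)). *)
Lemma head_law r a b : (S `|` @units C) r -> composable a b -> prec r (cmul a b) ->
  exists y, [/\ (S `|` @objects C) y, prec y b & prec r (cmul a y)].
Proof.
elim/generates_ind: a r b => [a Sa|a s IHa IHs as_] r b Sr ab rab.
  case: Sr => [Sr|ur]; last first.
    exists (tgt b); split; [by right; exact: objects_tgt | exact: prec_tgtl |].
    apply: prec_unit => //.
    by rewrite (prec_tgt rab) !tgt_mul // /composable tgt_tgt.
  (* A common multiple t in S of r and a that divides a b. Its cofactor a' is a right divisor of t,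
     hence lies in [sharp S], and supplies y up to a unit. *)
  have [t [St rt at_ tab]] : exists t, [/\ S t, prec r t, prec a t & prec t (cmul a b)].
    case: Sa => [Sa|ua]; last first.
      exists r; split=> //; first exact: prec_refl.
      by apply: prec_unit => //; rewrite (prec_tgt rab) tgt_mul.
    case: S_garside => + _ _ _; apply=> //; exact: prec_mulr.
  move/precP: at_ => [a' aa' tE].
  have Sa' : sharp S a'.
    apply: sharp_rdivisor aa' _; rewrite -tE; left; exists t => //.
    by apply/(eqstarP C_lcancel); split; exact: prec_refl.
  have a'b : prec a' b by rewrite tE in tab; exact: prec_cancel tab.
  have [y [Sy ya' a'y]] := sharp_repr Sa'.
  exists y; split=> //; first exact: prec_trans a'b.
  by apply: prec_trans rt _; rewrite tE; exact: prec_mull.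
have sb : composable s b by rewrite /composable -(dom_mul as_).
have asb : composable a (cmul s b) by rewrite /composable tgt_mul.
rewrite -mul_assoc // in rab.
have [y [Sy ysb ray]] := IHa _ _ Sr asb rab.
have [y' [Sy' y'b ysy']] := IHs _ _ (sub_S_units Sy) sb ysb.
exists y'; split=> //; apply: prec_trans ray _.
rewrite -mul_assoc //; last by rewrite /composable (prec_tgt y'b).
by apply: prec_mull => //; rewrite /composable (prec_tgt ysb).
Qed.

(** In a product a b, the delicate case is that of a unit a and some s in S dividing b. Then a s is
    a right divisor of s, so it lies in [sharp S], and its representative is no object because s is
    no unit. *)
Lemma nonunit_divisor a : ~ units a -> exists2 s, S s & prec s a.
Proof.
elim/generates_ind: a => [s [Ss|us]|a b IHa IHb ab] // nu.
  by exists s => //; exact: prec_refl.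
have [ua|/IHa[s Ss sa]] := pselect (units a); last first.
  by exists s => //; apply: prec_trans sa _; exact: prec_mulr.
have [ub|/IHb[s Ss sb]] := pselect (units b); first by case: nu; exact: unit_mul.
have as_ : composable a s by apply/(composable_prec _ sb).
have [v [uv av va avE vaE]] := unit_inv ua.
have vas : composable v (cmul a s) by rewrite /composable tgt_mul.
have : sharp S (cmul a s).
  apply: (sharp_rdivisor vas); rewrite mul_assoc // vaE as_ mul_tgt.
  by left; exists s => //; apply/(eqstarP C_lcancel); split; exact: prec_refl.
move=> /sharp_repr[s' [[Ss'|os'] s'as as_s']].
  exists s' => //; apply: prec_trans s'as _; exact: prec_mull.
exfalso; apply: (nonunit Ss).
have /(unitP C_lcancel) uas : units (cmul a s).
  by apply: unit_prec as_s' => //; exact: unit_object.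
apply/(unitP C_lcancel); apply: (prec_cancel C_lcancel (c := a)) => //.
  by rewrite /composable tgt_tgt.
rewrite -as_ mul_dom; apply: prec_trans uas _.
by rewrite tgt_mul //; exact: prec_tgtl.
Qed.

(** Letters may be units, so words can be padded to any greater length. Words of growing length
    exhaust C and measure how far two filters agree. *)
Inductive word : nat -> C -> Prop :=
| word0 v : objects v -> word 0 v
| wordS k s r : (S `|` @units C) s -> word k r -> composable s r ->
    word k.+1 (cmul s r).

Lemma word1 s : (S `|` @units C) s -> word 1 s.
Proof.
move=> Ss; rewrite -(mul_dom s); apply: wordS => //; last exact: composable_dom.
by apply: word0; exact: objects_dom.
Qed.

Lemma word_mul k l a b : word k a -> word l b -> composable a b ->
  word (k + l) (cmul a b).
Proof.
move=> wa; elim: wa b => [v ov|{}k s r Ss wr IH sr] b wb.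
  by rewrite /composable dom_object// => ->; rewrite mul_tgt.
rewrite /composable dom_mul // => rb.
by rewrite -mul_assoc //; apply: wordS (IH _ wb rb) _ => //; rewrite /composable tgt_mul.
Qed.

Lemma word_exists a : exists k, word k a.
Proof.
elim/generates_ind: a => [s /word1|a b [k wa] [l wb] ab]; first by exists 1.
by exists (k + l); exact: word_mul.
Qed.

Lemma word_leq k l a : k <= l -> word k a -> word l a.
Proof.
move=> /subnK <- wa; elim: (l - k) => // n wn.
rewrite -(mul_tgt a); apply: wordS => //; last exact: composable_tgt.
by right; apply: (unit_object C_lcancel); exact: objects_tgt.
Qed.

(** The H-law is iterated letter by letter: if s is the first letter of r and y the divisor of b it
    yields, then a y = s a' and b = y b', and after cancelling s the rest of r divides a' b'. *)
Lemma head_law_word k r a b : word k r -> composable a b -> prec r (cmul a b) ->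
  exists y, [/\ word k y, prec y b & prec r (cmul a y)].
Proof.
move=> wr; elim: wr a b => [v ov|{}k s r' Ss wr' IH sr'] a b ab rab.
  exists (tgt b); split; [by apply: word0; exact: objects_tgt | exact: prec_tgtl |].
  rewrite -ab mul_dom; move: rab => /(prec_object _ ov) <-; rewrite tgt_mul //.
  exact: prec_tgtl.
have sab : prec s (cmul a b) by apply: prec_trans rab; exact: prec_mulr.
have [y [Sy yb say]] := head_law Ss ab sab.
have ay : composable a y by apply/(composable_prec _ yb).
move/precP: yb => [b' yb' bE]; move/precP: say => [a' sa' ayE].
have a'b' : composable a' b' by rewrite /composable -(dom_mul sa') -ayE dom_mul.
have r'a'b' : prec r' (cmul a' b').
  apply: (prec_cancel C_lcancel (c := s)) => //; first by rewrite /composable tgt_mul.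
  by rewrite mul_assoc // -ayE -mul_assoc // -bE.
have [y' [wy' y'b' r'y']] := IH _ _ a'b' r'a'b'.
have yy' : composable y y' by apply/(composable_prec _ y'b').
exists (cmul y y'); split.
- by apply: wordS => //; exact: sub_S_units.
- by rewrite bE; exact: prec_mull.
- have a'y' : composable a' y' by apply/(composable_prec _ y'b').
  by rewrite mul_assoc // ayE -mul_assoc //; exact: prec_mull.
Qed.

End Garside.

(** * Filters *)

Section Filters.
Variable C : smallCategory.
Implicit Types (a b c x y z : C) (F G : set C).

Definition is_filter F : Prop :=
  [/\ F !=set0, forall a b, prec a b -> F b -> F a &
      forall a b, F a -> F b -> exists c, [/\ F c, prec a c & prec b c]].

Definition prefixes c : set C := [set x | prec x c].

(** This is cF; divisors are added because the products c y alone need not be closed under them. *)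
Definition lact c F : set C :=
  [set x | exists2 y, F y /\ composable c y & prec x (cmul c y)].

Definition cut c F : set C := [set y | composable c y /\ F (cmul c y)].

Lemma filter_tgt F a b : is_filter F -> F a -> F b -> tgt a = tgt b.
Proof. by move=> [_ _ Fdir] Fa Fb; have [c [_ /prec_tgt-> /prec_tgt->]] := Fdir _ _ Fa Fb. Qed.

Lemma filter_mem_tgt F a : is_filter F -> F a -> F (tgt a).
Proof. by move=> [_ + _]; apply; exact: prec_tgtl. Qed.

Lemma filter_composable F c y : is_filter F -> F (dom c) -> F y -> composable c y.
Proof. by move=> fF Fc Fy; rewrite /composable -(filter_tgt fF Fc Fy) tgt_dom. Qed.

Lemma lact_mem F c y : composable c y -> F y -> lact c F (cmul c y).
Proof. by move=> cy Fy; exists y => //; exact: prec_refl. Qed.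

Lemma lact_self F c : F (dom c) -> lact c F c.
Proof.
move=> Fc; exists (dom c); last by rewrite mul_dom; exact: prec_refl.
by split=> //; exact: composable_dom.
Qed.

Lemma filter_lact F c : is_filter F -> F (dom c) -> is_filter (lact c F).
Proof.
move=> [_ _ Fdir] Fc; split; first by exists c; exact: lact_self.
  by move=> a b ab [y Fy by_]; exists y => //; exact: prec_trans by_.
move=> a b [y [Fy cy] ay] [y' [Fy' cy'] by'].
have [z [Fz yz y'z]] := Fdir _ _ Fy Fy'.
exists (cmul c z); split.
- by apply: lact_mem => //; apply/(composable_prec _ yz).
- by apply: prec_trans ay _; exact: prec_mull.
- by apply: prec_trans by' _; exact: prec_mull.
Qed.

Lemma cut_dom F c : F c -> cut c F (dom c).
Proof. by move=> Fc; split; [exact: composable_dom | rewrite mul_dom]. Qed.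

Lemma cut_mul F c d : composable c d -> cut d (cut c F) = cut (cmul c d) F.
Proof.
move=> cd; apply/seteqP; split=> x [].
  by move=> dx []; rewrite mul_assoc // => _ ?; split; rewrite // /composable dom_mul.
rewrite /composable dom_mul // => dx; rewrite -mul_assoc // => Fx; split=> //; split=> //.
by rewrite /composable tgt_mul.
Qed.

Lemma cut_object F v : is_filter F -> objects v -> F v -> cut v F = F.
Proof.
move=> fF ov Fv; apply/seteqP; split=> [x []|x Fx].
  by rewrite /composable dom_object// => ->; rewrite mul_tgt.
have vx : composable v x by apply: filter_composable fF _ Fx; rewrite dom_object.
by split=> //; rewrite -(dom_object ov) vx mul_tgt.
Qed.

Lemma lact_mul F c d : is_filter F -> composable c d -> F (dom d) ->
  lact c (lact d F) = lact (cmul c d) F.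
Proof.
move=> fF cd Fd; apply/seteqP; split=> x.
  move=> [y [[z [Fz dz] ydz] cy] xcy]; exists z.
    by split=> //; rewrite /composable dom_mul.
  by rewrite -mul_assoc //; apply: prec_trans xcy _; exact: prec_mull.
move=> [y [Fy]]; rewrite /composable dom_mul // => dy; rewrite -mul_assoc // => xcdy.
by exists (cmul d y) => //; split; [exact: lact_mem | rewrite /composable tgt_mul].
Qed.

Hypothesis C_lcancel : left_cancellative C.

Lemma filter_cut F c : is_filter F -> F c -> is_filter (cut c F).
Proof.
move=> [_ Fle Fdir] Fc; split; first by exists (dom c); exact: cut_dom.
  move=> a b ab [cb Fcb]; have ca : composable c a by apply/(composable_prec _ ab).
  by split=> //; apply: Fle Fcb; exact: prec_mull.
move=> a b [ca Fca] [cb Fcb]; have [z [Fz az bz]] := Fdir _ _ Fca Fcb.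
have /precP[w cw zE] := prec_trans (prec_mulr ca) az.
exists w; split; first by split=> //; rewrite -zE.
  by apply: (prec_cancel C_lcancel (c := c)); rewrite // -zE.
by apply: (prec_cancel C_lcancel (c := c)); rewrite // -zE.
Qed.

Lemma cut_lact F c : is_filter F -> F (dom c) -> cut c (lact c F) = F.
Proof.
move=> fF Fc; apply/seteqP; split=> [y [cy [z [Fz cz]]]|y Fy].
  by move/(prec_cancel C_lcancel cy cz); move=> yz; case: fF => _ Fle _; exact: Fle yz Fz.
have cy := filter_composable fF Fc Fy.
by split=> //; exact: lact_mem.
Qed.

Lemma lact_cut F c : is_filter F -> F c -> lact c (cut c F) = F.
Proof.
move=> [_ Fle Fdir] Fc; apply/seteqP; split=> [x [y [[_ Fcy] _]]|x Fx].
  by move/Fle; apply.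
have [z [Fz /precP[y cy zE] xz]] := Fdir _ _ Fc Fx; subst z.
by exists y.
Qed.

Lemma lact_prefixes z : lact z (prefixes (dom z)) = prefixes z.
Proof.
apply/seteqP; split=> x.
  by move=> [y [ydz zy] xzy]; apply: prec_trans xzy _; rewrite -{2}(mul_dom z); exact: prec_mull.
by move=> xz; exists (dom z); [split; [exact: prec_refl | exact: composable_dom] | rewrite mul_dom].
Qed.

Lemma prefixes_unit u : units u -> prefixes u = prefixes (tgt u).
Proof.
move=> uu; apply/seteqP; split=> x xu; apply: prec_trans xu _.
  exact/unitP.
exact: prec_tgtl.
Qed.

End Filters.

(** * Subsequences and pointwise limits of filters *)

Lemma finite_range (T : Type) (A : set T) : finite_set A ->
  exists n (g : 'I_n -> T), A = range g.
Proof.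
move=> /(@finite_seqP {classic T})[s ->].
exists (size s), (tnth (in_tuple s)); apply/seteqP; split=> x /=.
  by move=> /seq_tnthP[i ->]; exists i.
by move=> [i _ <-]; exact: mem_tnth.
Qed.

Lemma near_subseq (k : nat -> nat) (P : nat -> Prop) : {homo k : m n / m < n} ->
  (\forall n \near \oo, P n) -> \forall n \near \oo, P (k n).
Proof.
move=> k_homo [N _ PN]; exists N => // n /= Nn; apply: PN => /=.
apply: leq_trans Nn _; elim: n => // n IHn; apply: leq_ltn_trans IHn _.
exact: k_homo.
Qed.

Section Limits.
Variable C : smallCategory.
Implicit Types (F : set C).

Definition pointwise_limit (u : nat -> set C) F : Prop :=
  forall c, \forall n \near \oo, u n c <-> F c.

(** Finite alignment leaves finitely many candidates for a common multiple of a and b. Their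
    memberships in [u n] stabilize simultaneously, so the candidate found in [u n] for large n lies
    in F. *)
Lemma pointwise_limit_filter (u : nat -> set C) F : finitely_aligned C ->
  (forall n, is_filter (u n)) -> pointwise_limit u F -> F !=set0 -> is_filter F.
Proof.
move=> C_aligned fu uF F0; split=> // [a b ab Fb|a b Fa Fb].
  near \oo => n; have [_ ule _] := fu n.
  have uFa : u n a <-> F a by near: n; exact: uF.
  have uFb : u n b <-> F b by near: n; exact: uF.
  by apply/uFa/(ule _ _ ab)/uFb.
have [G /finite_range[m [g ->]] abG] := C_aligned a b.
near \oo => n; have [_ ule udir] := fu n.
have uFa : u n a <-> F a by near: n; exact: uF.
have uFb : u n b <-> F b by near: n; exact: uF.
have uFg : forall i, u n (g i) <-> F (g i).
  by near: n; apply: filter_forall => i; exact: uF.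
have [c [uc ac bc]] := udir _ _ (uFa.2 Fa) (uFb.2 Fb).
have : (lmulset a setT `&` lmulset b setT) c by [].
rewrite abG => -[_ [i _ <-] gic]; exists (g i).
have : (lmulset a setT `&` lmulset b setT) (g i).
  by rewrite abG; exists (g i) => //; exact: prec_refl.
by move=> [agi bgi]; split=> //; apply/uFg; exact: ule gic uc.
Unshelve. all: by end_near.
Qed.

(** Sequential compactness of the power set of a countable set: an ultrafilter refining the cofinite
    filter decides each membership, and indices are picked at which u agrees with the limit on
    longer and longer initial parts of C. *)
Lemma pointwise_limit_subseq (u : nat -> set C) : countable [set: C] ->
  exists k : nat -> nat, exists2 F,
    {homo k : m n / (m < n)%N} & pointwise_limit (u \o k) F.
Proof.
move=> /countable_injP[e einj].
have [U [uU leU]] := ultraFilterLemma (eventually_filter : ProperFilter \oo).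
have pU : ProperFilter U by exact: ultra_proper.
pose F : set C := [set c | U [set i | u i c]].
pose A n : set nat := [set i | forall c, e c <= n -> u i c <-> F c].
have UF c : U [set i | u i c <-> F c].
  have [Fc|nFc] := pselect (F c).
    by apply: filterS (Fc) => i /= uc; split.
  case: (in_ultra_setVsetC [set i | u i c] uU) => // nU.
  by apply: filterS nU => i /= nuc; split.
have UE n : U [set i | forall c, e c = n -> u i c <-> F c].
  have [[c ecn]|nc] := pselect (exists c, e c = n).
    apply: filterS (UF c) => i /= ucF d edn.
    by have <- : c = d by apply: einj; rewrite ?inE// ecn.
  by apply: filterS filterT => i _ c ecn; case: nc; exists c.
have UA n : U (A n).
  elim: n => [|n IHn].
    by apply: filterS (UE 0) => i /= ucF c; rewrite leqn0 => /eqP; exact: ucF.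
  apply: filterS2 IHn (UE n.+1) => i /= uin ui c.
  by rewrite leq_eqVlt => /predU1P[/ui|/uin].
have Aex n N : exists i, A n i /\ N <= i.
  have UN : U [set i | N <= i] by apply: leU; exact: nbhs_infty_ge.
  have : U (A n `&` [set i | N <= i]) by exact: filterI.
  by move/filter_ex => [i [Ai Ni]]; exists i.
have [h hP] := choice (fun nN => Aex nN.1 nN.2).
(* The bound [(k m).+1] makes k strictly increasing while [k n] stays in [A n]. *)
pose k := fix k n := if n is m.+1 then h (m.+1, (k m).+1) else h (0, 0).
exists k, F.
  by apply: homo_ltn ltn_trans _ => n; exact: (hP (n.+1, (k n).+1)).2.
have Ak n : A n (k n) by case: n => [|n]; [exact: (hP (0, 0)).1 | exact: (hP (n.+1, _)).1].
by move=> c; near=> n; apply: (Ak n); near: n; exact: nbhs_infty_ge.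
Unshelve. all: by end_near.
Qed.

End Limits.

(** * Heads of filters *)

Section Heads.
Variables (C : smallCategory) (S : set C).
Implicit Types (a b c r s t u v x y z : C) (F G : set C) (X : set (set C)).

(* The head of F is the greatest element of S in F, or the object of F when F
   contains no element of S. *)
Definition filter_head F x : Prop :=
  [/\ (S `|` @objects C) x, F x & forall r, S r -> F r -> prec r x].

Lemma normal_path2P s t : normal_path S s [:: t] <->
  [/\ sharp S s, sharp S t, composable s t &
      forall r, S r -> prec r (cmul s t) -> prec r s].
Proof.
change ([/\ `[<sharp S s>] && (`[<sharp S t>] && true), `[<composable s t>] && true &
  `[<forall r, S r -> prec r (cmul s t) -> prec r s>] && true] <->
  [/\ sharp S s, sharp S t, composable s t &
      forall r, S r -> prec r (cmul s t) -> prec r s]).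
rewrite !andbT.
by split=> [[/andP[/asboolP ? /asboolP ?] /asboolP ? /asboolP ?]|[? ? ? ?]];
  split=> //; [apply/andP; split | |]; exact/asboolP.
Qed.

(** The counterpart of [closed_invariant] for filters. Translations and their inverses generate I_l,
    so invariance is asked for these only; sequential closure is enough because C is countable. *)
Definition closed_invariant_filters : set (set (set C)) :=
  [set X | [/\ forall F, X F -> is_filter F,
     forall F c, X F -> F (dom c) -> X (lact c F),
     forall F c, X F -> F c -> X (cut c F) &
     forall (u : nat -> set C) F, (forall n, X (u n)) -> is_filter F ->
       pointwise_limit u F -> X F]].

(** For an object v, [prefixes v] is the set of units with target v, the only filter with head v. *)
Definition pair_of_filters X : set C * set C :=
  ([set s | S s /\ exists2 F, X F & filter_head F s],
   [set v | objects v /\ X (prefixes v)]).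

Definition head_in (TD : set C * set C) F : Prop :=
  exists2 x, filter_head F x & (TD.1 `|` TD.2) x.

Definition filters_of_pair (TD : set C * set C) : set (set C) :=
  [set F | is_filter F /\ forall c, F c -> head_in TD (cut c F)].

Hypothesis C_lcancel : left_cancellative C.
Hypothesis S_garside : garside_family S.
Hypothesis S_nonunit : S `&` @units C = set0.
Hypothesis S_transverse : eqstar_transverse S.
Hypothesis S_bounded : locally_bounded S.

Let nonunit := nonunit S_nonunit.
Let nonobject := nonobject C_lcancel S_nonunit.

(** If no element of S in F were greatest, each such s would miss some r. A common multiple in F and
    closure under right comultiples give a strictly larger t, and dependent choice builds a chain
    excluded by local boundedness. *)
Lemma filter_head_exists F : is_filter F -> exists x, filter_head F x.
Proof.
move=> fF; have [[c Fc] Fle Fdir] := fF.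
have [[s0 [Ss0 Fs0]]|noS] := pselect (exists s, S s /\ F s); last first.
  exists (tgt c); split; [by right; exact: objects_tgt | exact: filter_mem_tgt |].
  by move=> r Sr Fr; case: noS; exists r.
apply: contrapT => nohead.
pose SF := {s | S s /\ F s}.
have next (s : SF) : {s' : SF | sprec (sval s) (sval s')}.
  case: s => s [Ss Fs]; apply: cid => /=.
  have [r [Sr Fr rs]] : exists r, [/\ S r, F r & ~ prec r s].
    apply: contrapT => max; apply: nohead; exists s; split=> //; first by left.
    by move=> r Sr Fr; apply: contrapT => rs; apply: max; exists r.
  have [a [Fa ra sa]] := Fdir _ _ Fr Fs.
  case: S_garside => /(_ r s a Sr Ss ra sa)[t [St rt st ta]] _ _ _.
  exists (exist _ t (conj St (Fle _ _ ta Fa))); apply/sprecP; split=> //= ts.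
  by apply: rs; exact: prec_trans ts.
have [f [_ fP]] := dependent_choice next (exist _ s0 (conj Ss0 Fs0)).
apply: (S_bounded (objects_tgt c)); exists (sval \o f) => n; split=> //=.
case: (f n) => s [Ss Fs] /=; exists s; rewrite (filter_tgt fF Fc Fs) ?mul_tgt//.
by split=> //; exact: composable_tgt.
Qed.

Lemma filter_head_unique F x y : is_filter F ->
  filter_head F x -> filter_head F y -> x = y.
Proof.
move=> fF [[Sx|ox] Fx xmax] [[Sy|oy] Fy ymax].
- by apply: S_transverse => //; apply/(eqstarP C_lcancel); split; [exact: ymax | exact: xmax].
- case: (nonunit Sx); apply: unit_prec (ymax _ Sx Fx) => //; exact: unit_object.
- case: (nonunit Sy); apply: unit_prec (xmax _ Sy Fy) => //; exact: unit_object.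
- by have := filter_tgt fF Fx Fy; case/objectP: ox => ->; case/objectP: oy => ->.
Qed.

Lemma filter_head_prec F x r : is_filter F -> filter_head F x ->
  (S `|` @units C) r -> F r -> prec r x.
Proof.
move=> fF [_ Fx xmax] [Sr|ur] Fr; first exact: xmax.
by apply: prec_unit => //; exact: filter_tgt fF _ _.
Qed.

(** A nonunit in F would have a divisor in S; this would divide v and so be a unit. *)
Lemma filter_head_object F v : is_filter F -> objects v -> filter_head F v -> F = prefixes v.
Proof.
move=> fF ov [_ Fv vmax]; have [_ Fle _] := fF.
apply/seteqP; split=> [x Fx|x xv]; last exact: Fle xv Fv.
have ux : units x.
  apply: contrapT => /(nonunit_divisor C_lcancel S_garside S_nonunit)[s Ss sx].
  apply: (nonunit Ss); apply: unit_prec (vmax _ Ss (Fle _ _ sx Fx)) => //.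
  exact: unit_object.
by apply: prec_unit => //; exact: filter_tgt fF _ _.
Qed.

Lemma filter_head_prefixes v : objects v -> filter_head (prefixes v) v.
Proof.
move=> ov; split; [by right | exact: prec_refl | by []].
Qed.

(** By the H-law, a divisor in S of z y with y in G already divides z y' for some y' in G that is an
    object or in S, and y' divides the head g. *)
Lemma filter_head_lact G g z s : is_filter G -> filter_head G g -> G (dom z) ->
  is_head S (cmul z g) s -> filter_head (lact z G) s.
Proof.
move=> fG gG Gz [Ss szg smax]; have [_ Gg _] := gG; have [_ Gle _] := fG.
have zg := filter_composable fG Gz Gg.
split; [by left | by exists g |].
move=> r Sr [y [Gy zy] rzy].
have [y' [Sy' y'y rzy']] := head_law C_lcancel S_garside (or_introl Sr) zy rzy.
apply: smax => //; apply: prec_trans rzy' _.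
have Gy' : G y' by exact: Gle y'y Gy.
apply: prec_mull; first by apply/(composable_prec _ y'y).
by apply: (filter_head_prec fG gG) Gy'; exact: (sub_S_units C_lcancel Sy').
Qed.

(* H-invariance extends to units acting on T: by admissibility t is the head of
   t y for some y in T or D, so H(zt) = H(zt y) is covered by the nonunit zt. *)
Lemma H_invariant_unit T D t z : T `<=` S -> admissible S T D -> H_invariant S T D ->
  T t -> composable z t -> exists2 s, is_head S (cmul z t) s & T s.
Proof.
move=> TS adm inv Tt zt; have St := TS _ Tt.
have nzt : ~ units (cmul z t).
  move=> /(unitP C_lcancel) uzt; apply: (nonunit St); apply/(unitP C_lcancel).
  apply: (prec_cancel C_lcancel (c := z)) => //; first by rewrite /composable tgt_tgt.
  rewrite -zt mul_dom; apply: prec_trans uzt _.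
  by rewrite tgt_mul //; exact: prec_tgtl.
have [[t' Tt' /normal_path2P[_ _ tt' norm]]|Dt] := adm _ Tt; last first.
  have [] := inv _ _ nzt (or_intror Dt); first by rewrite /composable dom_mul // tgt_dom.
  by rewrite -(dom_mul zt) mul_dom => s; exists s.
have [|s [Ss s1 smax] Ts] := inv _ _ nzt (or_introl Tt').
  by rewrite /composable dom_mul.
exists s => //; split=> //; last first.
  move=> r Sr rzt; apply: smax => //; apply: prec_trans rzt _.
  by apply: prec_mulr; rewrite /composable dom_mul.
rewrite -mul_assoc // in s1.
have ztt' : composable z (cmul t t') by rewrite /composable tgt_mul.
(* Normality of t t' makes y divide t, so that s, a priori a divisor of z t t', divides z t. *)
have [y [Sy ytt' szy]] := head_law C_lcancel S_garside (or_introl Ss) ztt' s1.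
apply: prec_trans szy _; apply: prec_mull; first by apply/(composable_prec _ ytt').
case: Sy => [Sy|oy]; first exact: norm.
by apply/(prec_object _ oy); rewrite -(tgt_mul tt'); exact/(prec_object _ oy).
Qed.

(** H-invariance covers nonunits z, and [H_invariant_unit] covers units when the head is in T. When
    the head is in D, a unit z carries [prefixes (dom z)] to [prefixes (tgt z)], and closure of D
    under isomorphism applies. *)
Lemma head_in_lact TD G z : garside_pair S TD -> is_filter G -> head_in TD G ->
  G (dom z) -> head_in TD (lact z G).
Proof.
case: TD => T D [/= [TS Dobj Diso] [adm inv _]] fG [g gG TDg] Gz.
have Gg : G g by case: gG.
have zg := filter_composable fG Gz Gg.
have [[s hs Ts]|[uz Dg]] : (exists2 s, is_head S (cmul z g) s & T s) \/
    (units z /\ D g).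
  have [uz|nz] := pselect (units z); last by left; exact: inv.
  case: TDg => [Tg|Dg]; last by right.
  by left; exact: H_invariant_unit inv Tg zg.
- by exists s; [exact: filter_head_lact hs | left].
have gE : g = dom z by rewrite zg; case/objectP: (Dobj _ Dg) => ->.
exists (tgt z); last by right; apply: Diso => //; rewrite -gE.
rewrite (filter_head_object fG (Dobj _ Dg) gG) gE lact_prefixes (prefixes_unit C_lcancel uz).
by apply: filter_head_prefixes; exact: objects_tgt.
Qed.

(** If c = b z, then b^-1 F = z (c^-1 F). Hence tails need to be examined only for a cofinal set of
    c in F. *)
Lemma head_in_cut TD F b c : garside_pair S TD -> is_filter F -> prec b c -> F c ->
  head_in TD (cut c F) -> head_in TD (cut b F).
Proof.
move=> gTD fF /precP[z bz ->] Fbz hF; have [_ Fle _] := fF.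
have Fb : F b by apply: Fle Fbz; exact: prec_mulr.
have fb := filter_cut C_lcancel fF Fb.
have bFz : cut b F z by [].
rewrite -(lact_cut fb bFz); apply: head_in_lact => //.
- exact: filter_cut.
- by rewrite cut_mul.
- exact: cut_dom.
Qed.

(** An object or element of S divides [x n] iff it lies in [u n], so along every subsequence the
    eventual divisors are those in F. *)
Lemma filter_head_limit (u : nat -> set C) (x : nat -> C) F y :
  (forall n, is_filter (u n)) -> (forall n, filter_head (u n) (x n)) ->
  is_filter F -> filter_head F y -> pointwise_limit u F -> is_limit S x y.
Proof.
move=> fu ux fF Fy uF k k_homo.
have [Sy y1 _] := Fy; split.
  split=> //; near=> n; apply: (filter_head_prec (fu (k n)) (ux (k n))).
    exact: (sub_S_units C_lcancel).
  suff : u (k n) y <-> F y by move=> [_]; apply.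
  near: n; exact: (near_subseq (P := fun n => u n y <-> F y) k_homo (uF y)).
move=> r [Sr rx]; apply/sprecP => -[_ ry]; apply: ry.
apply: (filter_head_prec fF Fy); first exact: (sub_S_units C_lcancel).
near \oo => n.
suff [+ _] : u (k n) r <-> F r.
  have [_ ule _] := fu (k n); have [_ + _] := ux (k n).
  move=> ukn; apply; apply: ule ukn.
  by near: n.
near: n; exact: (near_subseq (P := fun n => u n r <-> F r) k_homo (uF r)).
Unshelve. all: by end_near.
Qed.

(** If infinitely many heads lie in T, closedness under limits applies to that subsequence.
    Otherwise the heads are eventually objects in D, and the head y of F, which divides them, equals
    them. *)
Lemma head_in_limit TD (u : nat -> set C) F : garside_pair S TD ->
  (forall n, is_filter (u n)) -> (forall n, head_in TD (u n)) -> is_filter F ->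
  pointwise_limit u F -> head_in TD F.
Proof.
case: TD => T D [/= [TS Dobj _] [_ _ clos]] fu hu fF uF.
have [y Fy] := filter_head_exists fF.
have /choice[x xP] : forall n, exists x, filter_head (u n) x /\ (T `|` D) x.
  by move=> n; have [z uz TDz] := hu n; exists z.
exists y => //=; have [h|] := pselect (forall N, exists n, N <= n /\ T (x n)).
  have [h' hP] := choice h.
  pose k := fix k n := if n is m.+1 then h' (k m).+1 else h' 0.
  have k_homo : {homo k : m n / m < n}.
    by apply: homo_ltn ltn_trans _ => n; exact: (hP (k n).+1).1.
  have Tk n : T ((x \o k) n) by case: n => [|n]; [exact: (hP 0).2 | exact: (hP (k n).+1).2].
  apply: (clos _ _ Tk); apply: (@filter_head_limit (u \o k)) Fy _ => //.
  - by move=> n; exact: fu.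
  - by move=> n; exact: (xP _).1.
  - by move=> c; exact: (near_subseq (P := fun n => u n c <-> F c)).
move=> /existsNP[N /forallNP hN]; right.
have [Sy y1 _] := Fy; near \oo => n.
have uny : u n y by suff : u n y <-> F y by [move=> [_]; apply]; near: n; exact: uF.
have Dx : D (x n).
  have [] := xP n => _ [Tx|//]; case: (hN n); split=> //.
  by near: n; exact: nbhs_infty_ge.
have ox := Dobj _ Dx.
have yx : prec y (x n).
  by apply: (filter_head_prec (fu n) (xP n).1) => //; exact: (sub_S_units C_lcancel).
case: Sy => [Sy|oy].
  by case: (nonunit Sy); apply: unit_prec yx => //; exact: unit_object.
suff <- : x n = y by [].
by move: yx => /(prec_object _ oy) <-; case/objectP: ox.
Unshelve. all: by end_near.
Qed.

(** * Closed invariant families of filters and their pairs *)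

Lemma closed_invariant_filters_of_pair TD : garside_pair S TD ->
  closed_invariant_filters (filters_of_pair TD).
Proof.
move=> gTD; split=> [F []//|F c [fF hF] Fc|F c [fF hF] Fc|u F uX fF uF].
- have fcF := filter_lact fF Fc; split=> // a acF.
  (* The element a divides some c y with y in F, and the tail of c F after c y is y^-1 F. *)
  have [y [Fy cy] acy] := acF.
  apply: (head_in_cut gTD fcF acy); first exact: lact_mem.
  by rewrite -cut_mul // cut_lact //; exact: hF.
- split; first exact: filter_cut.
  by move=> a [ca Fca]; rewrite cut_mul //; exact: hF.
- split=> // c Fc.
  (* The set c^-1 (u n) is a filter only if c is in [u n], so the sequence is shifted by N. *)
  have [N _ uc] : \forall n \near \oo, u n c.
    by apply: filterS (uF c) => n [_]; apply.
  have {}uc n : u (n + N) c by apply: uc; rewrite /= leq_addl.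
  apply: (@head_in_limit TD (fun n => cut c (u (n + N)))) => //.
  - by move=> n; apply: filter_cut => //; exact: (uX _).1.
  - by move=> n; apply: (uX _).2.
  - exact: filter_cut.
  - move=> a; have : \forall n \near \oo, u (n + N) (cmul c a) <-> F (cmul c a).
      apply: (near_subseq (P := fun n => u n (cmul c a) <-> F (cmul c a))) => //.
      by move=> m n; rewrite ltn_add2r.
    by apply: filterS => n uFca; split=> -[ca]; split=> //; apply/uFca.
Qed.

Lemma pair_of_filters_head X x : (forall F, X F -> is_filter F) ->
  ((pair_of_filters X).1 `|` (pair_of_filters X).2) x ->
  exists2 F, X F & filter_head F x.
Proof.
move=> fX [[_ [F XF Fx]]|[ox Xx]]; first by exists F.
by exists (prefixes x) => //; exact: filter_head_prefixes.
Qed.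

Lemma head_in_pair_of_filters X F : (forall F, X F -> is_filter F) -> X F ->
  head_in (pair_of_filters X) F.
Proof.
move=> fX XF; have [x Fx] := filter_head_exists (fX _ XF).
exists x => //; have [[Sx|ox] _ _] := Fx; first by left; split=> //; exists F.
by right; split=> //; rewrite -(filter_head_object (fX _ XF) ox Fx).
Qed.

Lemma garside_pair_of_filters X : countable [set: C] -> finitely_aligned C ->
  closed_invariant_filters X -> garside_pair S (pair_of_filters X).
Proof.
move=> C_countable C_aligned [fX Xlact Xcut Xlim].
split; split=> /=.
- by move=> s [].
- by move=> s [].
- move=> u uu [_ Xu]; split; first exact: objects_tgt.
  rewrite -(prefixes_unit C_lcancel uu) -lact_prefixes; apply: Xlact Xu _.
  exact: prec_refl.
(* Admissibility: the head g of t^-1 F follows t. If g is in S, divisors of t g in S lie in F and so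
   divide t; if g is an object, then t^-1 F is [prefixes (dom t)]. *)
- move=> t [St [F XF Ft]]; have [_ Ft1 tmax] := Ft; have fF := fX _ XF.
  have XG := Xcut _ _ XF Ft1.
  have [g [[Sg|og] Gg gmax]] := filter_head_exists (fX _ XG).
    left; exists g; first by split=> //; exists (cut t F) => //; split=> //; left.
    apply/normal_path2P; split.
    + by left; exists t => //; apply/(eqstarP C_lcancel); split; exact: prec_refl.
    + by left; exists g => //; apply/(eqstarP C_lcancel); split; exact: prec_refl.
    + by case: Gg.
    + move=> r Sr rtg; apply: tmax => //; have [_ Fle _] := fF.
      by apply: Fle rtg _; case: Gg.
  right; split; first exact: objects_dom.
  have GE := filter_head_object (fX _ XG) og.
  suff <- : g = dom t by rewrite -GE //; split=> //; right.
  have [] := Gg; rewrite /composable => -> _.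
  by case/objectP: og.
(* H-invariance: the head of a F is H(ax). It is no object, since a lies in a F and would be a
   unit. *)
- move=> a x na TDx ax; have [F XF Fx] := pair_of_filters_head fX TDx.
  have fF := fX _ XF; have [_ Fx1 xmax] := Fx.
  have Fa : F (dom a) by rewrite ax; exact: filter_mem_tgt.
  have XaF := Xlact _ _ XF Fa; have faF := fX _ XaF.
  have [h aFh] := filter_head_exists faF.
  have [[Sh|oh] aFh1 hmax] := aFh; last first.
    case: na; apply: (unit_prec C_lcancel (unit_object C_lcancel oh)).
    by have := lact_self Fa; rewrite (filter_head_object faF oh aFh).
  exists h; last by split=> //; exists (lact a F).
  split=> // [|r Sr rax]; last by apply: hmax => //; exists x.
  have [y [Fy ay] hay] := aFh1.
  have [y' [Sy' y'y hay']] := head_law C_lcancel S_garside (or_introl Sh) ay hay.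
  apply: prec_trans hay' _; apply: prec_mull.
    by apply/(composable_prec _ y'y).
  apply: (filter_head_prec fF Fx); first exact: (sub_S_units C_lcancel).
  by case: fF => _ Fle _; exact: Fle y'y Fy.
(* Filters in X with heads [t n] have a subsequence converging to some G in X. Maximality of s along
   this very subsequence makes s the head of G. *)
- move=> t s Tt ts.
  have /choice[F FP] : forall n, exists F, X F /\ filter_head F (t n).
    by move=> n; have [_ [G XG Gt]] := Tt n; exists G.
  have [k [G k_homo FG]] := pointwise_limit_subseq F C_countable.
  have [[Ss sdiv] smax] := ts _ k_homo.
  have Gs r : (S `|` @objects C) r ->
      (\forall n \near \oo, prec r ((t \o k) n)) -> G r.
    move=> Sr rt; near \oo => n.
    suff : (F \o k) n r <-> G r.
      move=> [+ _]; apply; have [_ Fle _] := fX _ (FP (k n)).1.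
      have [_ + _] := (FP (k n)).2; apply: Fle.
      by near: n.
    by near: n; exact: FG.
  have fG : is_filter G.
    apply: (pointwise_limit_filter C_aligned) FG _ => [n|]; first exact: fX (FP _).1.
    by exists s; exact: Gs.
  have XG : X G by apply: Xlim FG => // n; exact: (FP _).1.
  have [x Gx] := filter_head_exists fG; have [Sx Gx1 xmax] := Gx.
  have sx : prec s x.
    by apply: (filter_head_prec fG Gx); [exact: (sub_S_units C_lcancel) | exact: Gs].
  have xs : prec x s.
    apply: contrapT => xs; apply: (smax x); last exact/sprecP.
    split=> //; near=> n.
    apply: (filter_head_prec (fX _ (FP (k n)).1) (FP (k n)).2).
      exact: (sub_S_units C_lcancel).
    suff : (F \o k) n x <-> G x by move=> [_]; apply.
    by near: n; exact: FG.
  have Gsx : filter_head G s.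
    split=> //; first exact: Gs.
    by move=> r Sr Gr; apply: prec_trans xs; exact: xmax.
  have [z Gz] := head_in_pair_of_filters fX XG.
  by rewrite (filter_head_unique fG Gsx Gz).
Unshelve. all: by end_near.
Qed.

(** * Filters generated by greedy paths *)

Section GreedySequence.
Variable x : nat -> C.
Hypothesis xS : forall n, (S `|` @objects C) (x n).
Hypothesis x_path : forall n, composable (x n) (x n.+1).
Hypothesis x_greedy : forall n r, S r -> prec r (cmul (x n) (x n.+1)) -> prec r (x n).

(* The product of x i, ..., x (i + n). *)
Fixpoint segment (i n : nat) : C :=
  if n is m.+1 then cmul (x i) (segment i.+1 m) else x i.

Definition tail_filter i : set C := [set c | exists n, prec c (segment i n)].

Lemma segment_composable i n : composable (x i) (segment i.+1 n).
Proof.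
elim: n i => [|n IHn] i //=.
by rewrite /composable tgt_mul; [exact: x_path | exact: IHn].
Qed.

Lemma segment_leq i m n : m <= n -> prec (segment i m) (segment i n).
Proof.
elim: m n i => [|m IHm] [|n] i //=; first by move=> _; exact: prec_refl.
  by move=> _; apply: prec_mulr; exact: segment_composable.
by move=> mn; apply: prec_mull; [exact: segment_composable | exact: IHm].
Qed.

(** Greediness of neighbouring factors suffices: by the H-law r divides x i times some y that
    divides the later factors and is an object or in S, and inductively y divides [x i.+1]. *)
Lemma segment_head i n r : S r -> prec r (segment i n) -> prec r (x i).
Proof.
elim: n i r => [|n IHn] i r Sr //= rx.
have [y [Sy yx rxy]] := head_law C_lcancel S_garside (or_introl Sr) (segment_composable i n) rx.
apply: (x_greedy Sr); apply: prec_trans rxy _; apply: prec_mull.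
  by apply/(composable_prec _ yx); exact: segment_composable.
case: Sy => [Sy|oy]; first exact: IHn yx.
apply/(prec_object _ oy); move/(prec_object _ oy): yx => <-.
by rewrite -(segment_composable i n) (x_path i).
Qed.

Lemma filter_tail i : is_filter (tail_filter i).
Proof.
split.
- by exists (x i); exists 0; exact: prec_refl.
- by move=> a b ab [n bn]; exists n; exact: prec_trans bn.
- move=> a b [m am] [n bn]; exists (segment i (maxn m n)); split.
  + by exists (maxn m n); exact: prec_refl.
  + by apply: prec_trans am _; apply: segment_leq; exact: leq_maxl.
  + by apply: prec_trans bn _; apply: segment_leq; exact: leq_maxr.
Qed.

Lemma filter_head_tail i : filter_head (tail_filter i) (x i).
Proof.
split=> //; first by exists 0; exact: prec_refl.
by move=> r Sr [n]; exact: segment_head.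
Qed.

Lemma cut_tail i : cut (x i) (tail_filter i) = tail_filter i.+1.
Proof.
apply/seteqP; split=> y.
  move=> [xy [n xyn]]; exists n; apply: (prec_cancel C_lcancel xy).
    exact: segment_composable.
  exact: prec_trans xyn (segment_leq i (leqnSn n)).
move=> [n yn]; have xy : composable (x i) y.
  by apply/(composable_prec _ yn); exact: segment_composable.
by split=> //; exists n.+1; exact: prec_mull.
Qed.

(** The successor appears because [segment i n] has n + 1 factors. *)
Lemma cut_segment i n : cut (segment i n) (tail_filter i) = tail_filter (i + n).+1.
Proof.
elim: n i => [|n IHn] i /=; first by rewrite addn0 cut_tail.
rewrite -cut_mul; last exact: segment_composable.
by rewrite cut_tail IHn addSnnS.
Qed.

End GreedySequence.

(** Dependent choice builds a greedy path from x: by admissibility an element of T is followed by a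
    normal successor in T or by its domain in D, and an object is followed by itself. The tails of
    its filter have the later entries as heads. *)
Lemma filters_of_pair_head TD x : garside_pair S TD -> (TD.1 `|` TD.2) x ->
  exists2 F, filters_of_pair TD F & filter_head F x.
Proof.
move=> gTD TDx; have [[TS Dobj _] [adm _ _]] := gTD.
have next (y : {y | (TD.1 `|` TD.2) y}) : {z : {z | (TD.1 `|` TD.2) z} |
    composable (sval y) (sval z) /\
    forall r, S r -> prec r (cmul (sval y) (sval z)) -> prec r (sval y)}.
  apply: cid; case: y => y [Ty|Dy] /=; last first.
    exists (exist _ y (or_intror Dy)); have oy := Dobj _ Dy; split=> /=.
      by rewrite /composable dom_object//; case/objectP: oy.
    by move=> r Sr; rewrite -{2}(dom_object oy) mul_dom.
  have [[z Tz /normal_path2P[_ _ yz yzP]]|Dy] := adm _ Ty.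
    by exists (exist _ z (or_introl Tz)).
  exists (exist _ (dom y) (or_intror Dy)) => /=; split; first exact: composable_dom.
  by move=> r Sr; rewrite mul_dom.
have [f [f0 fP]] := dependent_choice next (exist _ x TDx).
pose xs n := sval (f n).
have xsS n : (S `|` @objects C) (xs n).
  by case: (svalP (f n)) => [/TS|/Dobj]; [left | right].
have xs_path n : composable (xs n) (xs n.+1) by exact: (fP n).1.
have xs_greedy n r := (fP n).2 r.
have x0 : xs 0 = x by rewrite /xs f0.
exists (tail_filter xs 0); last by rewrite -x0; exact: filter_head_tail.
split=> [|c [n cn]]; first exact: filter_tail.
apply: (head_in_cut gTD (filter_tail xs_path 0) cn).
  by exists n; exact: prec_refl.
rewrite cut_segment //; exists (xs (0 + n).+1); first exact: filter_head_tail.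
exact: (svalP (f _)).
Qed.

(** A filter is its own tail after its object, so its head lies in T or D; which of the two is
    settled by disjointness of S from the objects. *)
Lemma filters_of_pairK TD : garside_pair S TD -> pair_of_filters (filters_of_pair TD) = TD.
Proof.
case: TD => T D gTD; have [/= [TS Dobj _] _] := gTD.
have headTD F x : filters_of_pair (T, D) F -> filter_head F x -> (T `|` D) x.
  move=> [fF hF] Fx; have [_ Fx1 _] := Fx.
  have Fx0 := filter_mem_tgt fF Fx1.
  have := hF _ Fx0; rewrite cut_object //; last exact: objects_tgt.
  by move=> [y Fy TDy]; rewrite (filter_head_unique fF Fx Fy).
congr pair; apply/seteqP; split=> x.
- move=> [Sx [F FTD Fx]]; case: (headTD _ _ FTD Fx) => // /Dobj.
  by move/(nonobject Sx).
- move=> Tx; have [|F FTD Fx] := filters_of_pair_head gTD (x := x); first by left.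
  by split; [exact: TS | exists F].
- move=> [ox xTD]; case: (headTD _ _ xTD (filter_head_prefixes ox)) => // /TS Sx.
  by case: (nonobject Sx).
- move=> Dx; have [|F FTD Fx] := filters_of_pair_head gTD (x := x); first by right.
  have ox := Dobj _ Dx; split=> //.
  by have [fF _] := FTD; rewrite -(filter_head_object fF ox Fx).
Qed.

(** * Approximation of filters on words of bounded length *)

Lemma wordSP k r : word S k.+1 r ->
  exists s r', [/\ (S `|` @units C) s, word S k r', composable s r' & r = cmul s r'].
Proof.
move=> wr; have [n nE] : exists n, n = k.+1 by exists k.+1.
rewrite -nE in wr; case: wr nE => // l s r' Ss wr' sr' [<-].
by exists s, r'.
Qed.

Definition agree_upto k F G : Prop := forall r, word S k r -> F r <-> G r.

Lemma agree_upto_sym k F G : agree_upto k F G -> agree_upto k G F.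
Proof. by move=> FG r wr; rewrite FG. Qed.

(** The H-law for words replaces a witness y in F by a word of length k in F, which agreement puts
    into G. *)
Lemma agree_upto_lact k F G z : is_filter F -> agree_upto k F G ->
  forall r, word S k r -> lact z F r -> lact z G r.
Proof.
move=> [_ Fle _] FG r wr [y [Fy zy] rzy].
have [y' [wy' y'y rzy']] := head_law_word C_lcancel S_garside wr zy rzy.
exists y' => //; split; last by apply/(composable_prec _ y'y).
by apply/(FG _ wy'); exact: Fle y'y Fy.
Qed.

(** With x = s z, membership of s r in x F is membership of r in z F: a word of length k + 1 is
    reduced to one of length k. *)
Lemma agree_upto_lact_mul k F G x s r : is_filter F -> is_filter G ->
  agree_upto k F G -> F (dom x) -> G (dom x) -> prec s x -> word S k r ->
  composable s r -> lact x F (cmul s r) -> lact x G (cmul s r).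
Proof.
move=> fF fG FG Fz Gz /precP[z sz xE] wr sr; subst x; rewrite dom_mul // in Fz Gz.
rewrite -!lact_mul // => srF; apply: lact_mem => //.
apply: (agree_upto_lact fF FG wr).
suff : cut s (lact s (lact z F)) r.
  rewrite cut_lact //; first exact: filter_lact.
  by rewrite sz; apply: filter_mem_tgt (lact_self Fz); exact: filter_lact.
by [].
Qed.

(* The approximation of F is built from its head x: when x^-1 F agrees with G on
   words of length k, F = x (x^-1 F) agrees with x G on words of length k + 1,
   since the first letter of such a word in F or in x G divides x. *)
Lemma filters_of_pair_approx X F k : closed_invariant_filters X ->
  filters_of_pair (pair_of_filters X) F -> exists2 G, X G & agree_upto k.+1 F G.
Proof.
move=> [fX Xlact _ _]; elim: k F => [|k IHk] F [fF hF].
all: have [c Fc] : F !=set0 by case: fF.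
all: have := hF _ (filter_mem_tgt fF Fc).
all: rewrite cut_object //; [|exact: objects_tgt|exact: filter_mem_tgt].
all: move=> [x Fx TDx].
  (* Words of length one are single letters, and these lie in F, or in G, iff they divide the common
     head x. *)
  have [G XG Gx] := pair_of_filters_head fX TDx.
  exists G => // r /wordSP[s [v [Ss wv sv ->]]].
  have {wv} ov : objects v.
    have [n nE] : exists n, n = 0 by exists 0.
    by rewrite -nE in wv; case: wv nE.
  have -> : cmul s v = s by rewrite -{2}(mul_dom s) sv; case/objectP: ov => ->.
  have fG := fX _ XG.
  split=> [Fs|Gs].
    have sx := filter_head_prec fF Fx Ss Fs.
    by have [_ Gle _] := fG; have [_ + _] := Gx; exact: Gle.
  have sx := filter_head_prec fG Gx Ss Gs.
  by have [_ Fle _] := fF; have [_ + _] := Fx; exact: Fle.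
have [_ Fx1 _] := Fx.
have fF1 := filter_cut C_lcancel fF Fx1.
have [|G XG FG] := IHk (cut x F).
  by split=> // a [xa Fxa]; rewrite cut_mul //; exact: hF.
have fG := fX _ XG; have F1x := cut_dom Fx1.
have Gx : G (dom x).
  apply/FG => //; apply: (word_leq C_lcancel (k := 0)) => //.
  by apply: word0; exact: objects_dom.
exists (lact x G); first exact: Xlact.
have FE := lact_cut fF Fx1.
move=> r /wordSP[s [r' [Ss wr' sr' ->]]]; split=> [Fr|Gr].
  have sx : prec s x.
    apply: (filter_head_prec fF Fx Ss); have [_ Fle _] := fF.
    by apply: Fle Fr; exact: prec_mulr.
  by apply: (agree_upto_lact_mul fF1 fG FG) => //; rewrite FE.
(* As a word of length one, s is also a word of length k + 1, so its membership in x G carries over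
   to x (x^-1 F) = F, whose head is x. *)
have sx : prec s x.
  apply: (filter_head_prec fF Fx Ss); rewrite -FE.
  apply: (agree_upto_lact fG (agree_upto_sym FG)).
    exact: (word_leq C_lcancel _ (word1 Ss)).
  have [_ Gle _] := filter_lact fG Gx.
  by apply: Gle Gr; exact: prec_mulr.
rewrite -FE.
exact: (agree_upto_lact_mul fG fF1 (agree_upto_sym FG)) Gr.
Qed.

Lemma pair_of_filtersK X : countable [set: C] -> closed_invariant_filters X ->
  filters_of_pair (pair_of_filters X) = X.
Proof.
move=> /countable_injP[e einj] cX; have [fX Xlact Xcut Xlim] := cX.
apply/seteqP; split=> F; last first.
  move=> XF; split=> [|c Fc]; first exact: fX.
  by apply: head_in_pair_of_filters => //; exact: Xcut.
move=> FTD; have [fF _] := FTD.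
(* The finitely many elements with code at most n are words of a common length. Approximating F on
   that length for each n gives a sequence in X converging to F. *)
have wE n : exists k, forall c, e c <= n -> word S k.+1 c.
  have wE1 m : exists k, forall c, e c = m -> word S k.+1 c.
    have [[c ecm]|nc] := pselect (exists c, e c = m); last first.
      by exists 0 => c ecm; case: nc; exists c.
    have [k wk] := word_exists S_garside c.
    exists k => d edm; have <- : c = d by apply: einj; rewrite ?inE// ecm.
    exact: (word_leq C_lcancel (leqnSn k)).
  elim: n => [|n [k wk]].
    by have [k wk] := wE1 0; exists k => c; rewrite leqn0 => /eqP; exact: wk.
  have [l wl] := wE1 n.+1; exists (maxn k l) => c.
  rewrite leq_eqVlt => /predU1P[/wl|/wk]; apply: (word_leq C_lcancel).
    by rewrite ltnS leq_maxr.
  by rewrite ltnS leq_maxl.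
have /choice[G GP] : forall n, exists G, X G /\ forall c, e c <= n -> F c <-> G c.
  move=> n; have [k wk] := wE n.
  by have [G XG FG] := filters_of_pair_approx k cX FTD; exists G; split=> // c /wk /FG.
apply: (Xlim G) fF _ => [n|c]; first exact: (GP n).1.
near=> n; rewrite (GP n).2 //; near: n; exact: nbhs_infty_ge.
Unshelve. all: by end_near.
Qed.

End Heads.

(** * Characters and filters *)

Section UnitSpace.
Variable C : smallCategory.
Implicit Types (a b c d x y z : C) (F : set C) (e f g : J C) (s t : set (C * C)).
Implicit Types (chi : {ptws J C -> bool}) (X : set {ptws J C -> bool}) (Y : set (set C)).

(** Elements of I_l commute with right multiplication, by associativity for translations; this makes
    their domains right ideals. *)
Lemma left_inverse_hull_equivariant s x y : left_inverse_hull s -> s (x, y) ->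
  dom x = dom y /\ forall z, composable x z -> s (cmul x z, cmul y z).
Proof.
move=> hs; elim: hs x y => [c|{}s _ IH|{}s t _ IHs _ IHt] x y /=.
- move=> [/= cx ->]; split=> [|z xz]; first by rewrite dom_mul.
  by split; [rewrite /composable tgt_mul | rewrite mul_assoc].
- move=> /IH[yx sP]; split=> // z; rewrite /composable -yx; exact: sP.
- move=> [w /IHt[xw tP] /IHs[wy sP]]; split=> [|z xz]; first by rewrite xw.
  by exists (cmul w z); [exact: tP | apply: sP; rewrite /composable -xw].
Qed.

Lemma constructible_ideal (e : set C) x y : constructible e -> e x -> prec x y -> e y.
Proof.
move=> [s hs ->] [x' sxx'] /precP[z xz ->]; exists (cmul x' z).
by have [_] := left_inverse_hull_equivariant hs sxx'; apply.
Qed.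

Definition ideal c : set C := [set x | prec c x].

Definition finitely_generated (e : set C) : Prop :=
  exists2 A : set C, finite_set A & e = \bigcup_(c in A) ideal c.

Lemma finitely_generated_ideal c : finitely_generated (ideal c).
Proof. by exists [set c]; [exact: finite_set1 | rewrite bigcup_set1]. Qed.

Lemma finitely_generated_bigcup (I : Type) (A : set I) (B : I -> set C) :
  finite_set A -> (forall i, A i -> finitely_generated (B i)) ->
  finitely_generated (\bigcup_(i in A) B i).
Proof.
move=> finA AB.
have /choice[G GP] : forall i, exists G : set C,
    A i -> finite_set G /\ B i = \bigcup_(c in G) ideal c.
  move=> i; have [/AB[G finG BE]|nA] := pselect (A i); last by exists set0.
  by exists G.
exists (\bigcup_(i in A) G i); first by apply: bigcup_finite => // i /GP[].
apply/seteqP; split=> [x [i Ai]|x [c [i Ai Gc] cx]].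
  by have [_ ->] := GP _ Ai; move=> [c Gc cx]; exists c => //; exists i.
by exists i => //; have [_ ->] := GP _ Ai; exists c.
Qed.

Definition preimage_along s (e : set C) : set C := [set x | exists2 y, s (x, y) & e y].

Lemma preimage_along_comp s t (e : set C) :
  preimage_along (s \; t)%relation e = preimage_along t (preimage_along s e).
Proof.
apply/seteqP; split=> x /=.
  by move=> [y [z txz szy] ey]; exists z => //; exists y.
by move=> [z txz [y szy ey]]; exists y => //; exists z.
Qed.

Section FinitelyAligned.
Hypothesis C_lcancel : left_cancellative C.
Hypothesis C_aligned : finitely_aligned C.

(** Induction on I_l with the stronger property [good], kept for s and its inverse together. The
    preimage of dC under translation by c is c^-1 (cC ∩ dC), finitely generated by alignment; under
    the inverse translation it is (cd)C or empty. *)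
Lemma constructible_finitely_generated (e : set C) :
  constructible e -> finitely_generated e.
Proof.
pose good s := finitely_generated s.`1 /\
  forall c, finitely_generated (preimage_along s (ideal c)).
have preimage_fg s (e' : set C) :
    good s -> finitely_generated e' -> finitely_generated (preimage_along s e').
  move=> [_ sc] [A finA ->].
  suff -> : preimage_along s (\bigcup_(c in A) ideal c) =
      \bigcup_(c in A) preimage_along s (ideal c) by exact: finitely_generated_bigcup.
  apply/seteqP; split=> x; first by move=> [y sxy [c Ac cy]]; exists c => //; exists y.
  by move=> [c Ac [y sxy cy]]; exists y => //; exists c.
have good_comp s t : good s -> good t -> good (s \; t)%relation.
  move=> gs gt; split.
    suff -> : (s \; t)%relation.`1 = preimage_along t s.`1 by apply: preimage_fg gs.1.
    apply/seteqP; split=> x /=; first by move=> [y [z tz sz]]; exists z => //; exists y.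
    by move=> [z tz [y sz]]; exists y; exists z.
  by move=> c; rewrite preimage_along_comp; apply: preimage_fg (gs.2 c).
suff hull s : left_inverse_hull s -> good s /\ good (s^-1)%relation.
  by move=> [s /hull[[fs _] _] ->].
elim=> [c|{}s _ [gs gsV]|{}s t _ [gs gsV] _ [gt gtV]].
- split; split.
  + suff -> : (translation c).`1 = ideal (dom c) by exact: finitely_generated_ideal.
    apply/seteqP; split=> x /=; last first.
      move=> /(composable_prec c) cx; exists (cmul c x).
      by split=> //; apply/cx; exact: composable_dom.
    move=> [y [/= cx _]]; rewrite /ideal/= cx; exact: prec_tgtl.
  + move=> d; have [A finA cdA] := C_aligned c d.
    have inA w : A w -> prec c w /\ prec d w.
      move=> Aw; have : (lmulset c setT `&` lmulset d setT) w.
        by rewrite cdA; exists w => //; exact: prec_refl.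
      by [].
    have /choice[h hP] : forall w, exists x, A w -> composable c x /\ w = cmul c x.
      move=> w; have [Aw|nAw] := pselect (A w); last by exists w.
      by have [/precP[x cx wE] _] := inA _ Aw; exists x.
    exists (h @` A); first exact: finite_image.
    apply/seteqP; split=> x.
      move=> [y [/= cx ->]] dcx.
      have : (lmulset c setT `&` lmulset d setT) (cmul c x).
        by split=> //; exact: prec_mulr.
      rewrite cdA => -[w Aw wcx].
      have [cz wE] := hP _ Aw; exists (h w); first by exists w.
      by apply: (prec_cancel C_lcancel cz cx); rewrite -wE.
    move=> [_ [w Aw <-] zx].
    have [cz wE] := hP _ Aw; have [_ dw] := inA _ Aw.
    have cx : composable c x by apply/(composable_prec _ zx).
    exists (cmul c x) => //; apply: prec_trans dw _.
    by rewrite {1}wE; exact: prec_mull.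
  + suff -> : ((translation c)^-1)%relation.`1 = ideal c by exact: finitely_generated_ideal.
    apply/seteqP; split=> x /=; first by move=> [y [/= cy ->]]; exact: prec_mulr.
    by move=> /precP[y cy ->]; exists y.
  + move=> d; have [cd|ncd] := pselect (composable c d).
      suff -> : preimage_along (translation c)^-1%relation (ideal d) = ideal (cmul c d).
        exact: finitely_generated_ideal.
      apply/seteqP; split=> x; first by move=> [y [/= cy ->] dy]; exact: prec_mull.
      move=> /precP[z]; rewrite /composable dom_mul // => dz ->.
      exists (cmul d z); last exact: prec_mulr.
      by split=> /=; [rewrite /composable tgt_mul | rewrite mul_assoc].
    exists set0; first exact: finite_set0.
    rewrite bigcup_set0; apply/seteqP; split=> // x [y [/= cy _] dy].
    by apply: ncd; apply/(composable_prec _ dy).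
- by split.
- split; first exact: good_comp.
  suff -> : ((s \; t)^-1)%relation = (t^-1 \; s^-1)%relation by exact: good_comp.
  by apply/seteqP; split=> -[x y] /= [z]; exists z.
Qed.
End FinitelyAligned.

(** * Filters as characters in Omega *)

Lemma J_ext e f : sval e = sval f -> e = f.
Proof.
by case: e f => e he [f hf] /= ef; subst f; rewrite (Prop_irrelevance he hf).
Qed.

Lemma J_ideal e x y : sval e x -> prec x y -> sval e y.
Proof. exact: constructible_ideal (svalP e). Qed.

Definition Jideal c : J C :=
  Il_dom (exist _ (translation c)^-1%relation (hull_inv (hull_translation c))).

Lemma JidealE c : sval (Jideal c) = ideal c.
Proof.
apply/seteqP; split=> x /=; first by move=> [y [/= cy ->]]; exact: prec_mulr.
by move=> /precP[y cy ->]; exists y.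
Qed.

(** Translation by c after its inverse is the identity on cC; following it by the inverse of
    translation by d restricts the domain to dC. *)
Lemma J_ideal_meet c d : exists g, sval g = ideal c `&` ideal d.
Proof.
have h : left_inverse_hull
    ((translation d)^-1 \; (translation c \; (translation c)^-1))%relation.
  by do ?[apply: hull_comp|apply: hull_inv|apply: hull_translation].
exists (Il_dom (exist _ _ h)); apply/seteqP; split=> x /=.
  move=> [y [z [w [/= cw ->] [/= _ ->]] [/= dy cwE]]]; split; first exact: prec_mulr.
  by rewrite cwE; exact: prec_mulr.
move=> [/precP[w cw ->] /precP[y dy E]].
by exists y, (cmul c w) => //; exists w.
Qed.

Definition char_of F : {ptws J C -> bool} := fun e => `[< exists2 c, F c & sval e c >].

Definition filter_of chi : set C := [set c | chi (Jideal c)].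

Lemma char_ofP F e : char_of F e <-> exists2 c, F c & sval e c.
Proof. by split=> /asboolP. Qed.

Lemma char_of_Jideal F c : is_filter F -> char_of F (Jideal c) <-> F c.
Proof.
move=> [_ Fle _]; rewrite char_ofP; split=> [[x Fx]|Fc].
  by rewrite JidealE => cx; exact: Fle cx Fx.
by exists c; rewrite ?JidealE//; exact: prec_refl.
Qed.

Lemma char_ofK F : is_filter F -> filter_of (char_of F) = F.
Proof. by move=> fF; apply/seteqP; split=> c /(char_of_Jideal _ fF). Qed.

Lemma ptws_ext chi chi' : (forall e, chi e <-> chi' e) -> chi = chi'.
Proof. by move=> E; apply: funext => e; apply/idP/idP => /E. Qed.

Lemma Omega_char_of F : is_filter F -> Omega (char_of F).
Proof.
move=> fF; have [[c0 Fc0] _ Fdir] := fF; split; first split.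
- by exists (Jideal c0); apply/char_of_Jideal.
- by move=> e e0; apply/negP => /char_ofP[c _]; rewrite e0.
- move=> e f g gE; apply/idP/andP => [/char_ofP[c Fc]|[/char_ofP[a Fa ea] /char_ofP[b Fb fb]]].
    by rewrite gE => -[ec fc]; split; apply/char_ofP; exists c.
  have [c [Fc ac bc]] := Fdir _ _ Fa Fb; apply/char_ofP; exists c => //.
  by rewrite gE; split; [exact: J_ideal ea ac | exact: J_ideal fb bc].
- move=> e n f eE /char_ofP[c Fc]; rewrite eE => -[i _ fic].
  by exists i; apply/char_ofP; exists c.
Qed.

Lemma Omega_leq chi e f : Omega chi -> sval e `<=` sval f -> chi e -> chi f.
Proof.
move=> [[_ _ chiM] _] ef; have -> := chiM e f e; first by case/andP.
by apply/esym/setIidPl.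
Qed.

(** Finite generation writes e as a finite union of principal ideals, and the union condition in
    [Omega] selects one of them. *)
Lemma OmegaP chi e : left_cancellative C -> finitely_aligned C -> Omega chi ->
  chi e <-> exists2 c, filter_of chi c & sval e c.
Proof.
move=> C_lcancel C_aligned Ochi; split=> [chie|[c chic ec]]; last first.
  apply: (Omega_leq Ochi _ chic) => x; rewrite JidealE; exact: J_ideal.
have [A /finite_range[n [g ->]] eE] :=
  constructible_finitely_generated C_lcancel C_aligned (svalP e).
have eE' : sval e = \bigcup_i sval (Jideal (g i)).
  rewrite eE; apply/seteqP; split=> x.
    by move=> [_ [i _ <-] gix]; exists i; rewrite ?JidealE.
  by move=> [i _]; rewrite JidealE => gix; exists (g i) => //; exists i.
have [_ /(_ _ _ _ eE' chie)[i chigi]] := Ochi.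
exists (g i) => //; rewrite eE; exists (g i); first by exists i.
exact: prec_refl.
Qed.

Lemma filter_ofK chi : left_cancellative C -> finitely_aligned C -> Omega chi ->
  char_of (filter_of chi) = chi.
Proof.
move=> C_lcancel C_aligned Ochi; apply: ptws_ext => e.
by rewrite char_ofP (OmegaP _ C_lcancel C_aligned Ochi).
Qed.

Lemma filter_filter_of chi : left_cancellative C -> finitely_aligned C -> Omega chi ->
  is_filter (filter_of chi).
Proof.
move=> C_lcancel C_aligned Ochi; have [[[e chie] _ chiM] _] := Ochi.
have chiP f := OmegaP f C_lcancel C_aligned Ochi; split.
- by have /chiP[c chic _] := chie; exists c.
- move=> a b ab; apply: (Omega_leq Ochi) => x.
  by rewrite !JidealE; exact: prec_trans.
- move=> a b chia chib; have [g gE] := J_ideal_meet a b.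
  have /chiP[c chic] : chi g.
    rewrite (chiM (Jideal a) (Jideal b)); first exact/andP.
    by rewrite gE !JidealE.
  by rewrite gE => -[ac bc]; exists c.
Qed.

(** * The action of I_l in terms of filters *)

Definition Itranslation c : Il C := exist _ _ (hull_translation c).
Definition Icotranslation c : Il C := exist _ _ (hull_inv (hull_translation c)).

Lemma char_of_translation F c : is_filter F ->
  char_of F (Il_dom (Itranslation c)) <-> F (dom c).
Proof.
move=> fF; rewrite char_ofP; split=> [[x Fx [y [/= -> _]]]|Fc].
  exact: filter_mem_tgt.
by exists (dom c) => //; exists (cmul c (dom c)); split=> //; exact: composable_dom.
Qed.

Lemma act_translation F c : act (Itranslation c) (char_of F) = char_of (lact c F).
Proof.
apply: ptws_ext => e; rewrite /act !char_ofP; split.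
  by move=> [x Fx [y [/= cx ->] ey]]; exists (cmul c x) => //; exact: lact_mem.
by move=> [y [x [Fx cx] ycx] ey]; exists x => //; exists (cmul c x) => //; exact: J_ideal ycx.
Qed.

Lemma char_of_cotranslation F c : is_filter F ->
  char_of F (Il_dom (Icotranslation c)) <-> F c.
Proof. exact: char_of_Jideal. Qed.

Lemma act_cotranslation F c : act (Icotranslation c) (char_of F) = char_of (cut c F).
Proof.
apply: ptws_ext => e; rewrite /act !char_ofP; split.
  by move=> [y Fy [x [/= cx yE] ex]]; exists x => //; split=> //; rewrite -yE.
by move=> [x [cx Fcx] ex]; exists (cmul c x) => //; exists x.
Qed.

Definition filters_in X : set (set C) := [set F | is_filter F /\ X (char_of F)].

Definition chars_of Y : set {ptws J C -> bool} := char_of @` Y.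

Lemma act_invariant_chars_of Y :
  (forall F, Y F -> is_filter F) ->
  (forall F c, Y F -> F (dom c) -> Y (lact c F)) ->
  (forall F c, Y F -> F c -> Y (cut c F)) ->
  act_invariant (chars_of Y).
Proof.
move=> fY Ylact Ycut.
(* Quantifying over the membership proof h lets the induction run on relations. The inverse is
   carried along because inverses of composites are composites of inverses. *)
pose ok s := forall (h : left_inverse_hull s) chi, chars_of Y chi ->
  chi (Il_dom (exist _ s h)) -> chars_of Y (act (exist _ s h) chi).
have ok_comp s t : left_inverse_hull s -> left_inverse_hull t -> ok s -> ok t ->
    ok (s \; t)%relation.
  move=> hs ht oks okt h chi Ychi chist.
  have chit : chi (Il_dom (exist _ t ht)).
    move: Ychi chist => [F _ <-] /char_ofP[c Fc [y /= [z tcz _]]].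
    by apply/char_ofP; exists c => //; exists z.
  have -> : act (exist _ (s \; t)%relation h) chi =
      act (exist _ s hs) (act (exist _ t ht) chi).
    by apply: funext => e; congr chi; apply: J_ext; exact: preimage_along_comp.
  apply: oks; first exact: okt.
  suff -> : act (exist _ t ht) chi (Il_dom (exist _ s hs)) =
      chi (Il_dom (exist _ (s \; t)%relation h)) by [].
  congr chi; apply: J_ext; apply/seteqP; split=> x /=.
    by move=> [z txz [y szy]]; exists y; exists z.
  by move=> [y [z txz szy]]; exists z => //; exists y.
suff hull s : left_inverse_hull s -> ok s /\ ok (s^-1)%relation.
  by move=> [s hs] chi; have [oks _] := hull _ hs; exact: oks.
elim=> [c|{}s _ [oks oksV]|{}s t hs [oks oksV] ht [okt oktV]].
- split=> h chi [F YF <-]; have fF := fY _ YF.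
    rewrite (Prop_irrelevance h (hull_translation c)).
    move=> /(char_of_translation c fF) Fc; rewrite [act _ _]act_translation.
    by exists (lact c F) => //; exact: Ylact.
  rewrite (Prop_irrelevance h (hull_inv (hull_translation c))).
  move=> /(char_of_cotranslation c fF) Fc; rewrite [act _ _]act_cotranslation.
  by exists (cut c F) => //; exact: Ycut.
- by have -> : (s^-1^-1)%relation = s by apply/seteqP; split=> -[].
- split; first exact: ok_comp.
  have -> : ((s \; t)^-1)%relation = (t^-1 \; s^-1)%relation.
    by apply/seteqP; split=> -[x y] /= [z]; exists z.
  by apply: ok_comp => //; exact: hull_inv.
Qed.

(** * Pointwise topology and closedness *)

Lemma ptws_nbhs_eval chi e : nbhs chi [set chi' : {ptws J C -> bool} | chi' e = chi e].
Proof.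
have /cvg_sup/(_ e) : chi --> chi by exact: cvg_id.
apply; rewrite nbhsE; exists [set chi' | chi' e = chi e] => //; split=> //.
by exists [set chi e]; [exact: discrete_open | ].
Qed.

Lemma ptws_cvg (u : nat -> {ptws J C -> bool}) chi :
  (forall e, \forall n \near \oo, u n e = chi e) -> u @ \oo --> chi.
Proof.
move=> uchi; apply/cvg_sup => e A; rewrite nbhsE => -[B [[W oW <-] Wchi] WA].
apply: filterS (uchi e) => n unchi; apply: WA.
by rewrite /= unchi.
Qed.

(** Characters in Omega are determined by their values on principal ideals, and C is countable. A
    point of the closure in Omega is thus the limit of filters in Y that agree with it on longer and
    longer initial parts of C. *)
Lemma closed_chars_of Y : countable [set: C] -> left_cancellative C ->
  finitely_aligned C -> closed_invariant_filters Y ->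
  closed (chars_of Y : set (subspace (@Omega C))).
Proof.
move=> /countable_injP[h hinj] C_lcancel C_aligned [fY _ _ Ylim].
have YO : chars_of Y `<=` @Omega C.
  by move=> _ [F YF <-]; apply: Omega_char_of; exact: fY.
apply/closed_subspaceP; exists (closure (chars_of Y)); first exact: closed_closure.
rewrite (setIidl YO); apply/seteqP; split=> [chi [clchi Ochi]|chi Ychi]; last first.
  by split; [exact: subset_closure | exact: YO].
have nbhs_agree n : nbhs chi
    [set chi' : {ptws J C -> bool} | forall c, h c <= n -> chi' (Jideal c) = chi (Jideal c)].
  have agree1 m : nbhs chi
      [set chi' : {ptws J C -> bool} | forall c, h c = m -> chi' (Jideal c) = chi (Jideal c)].
    have [[c hcm]|nc] := pselect (exists c, h c = m); last first.
      by apply: filterS filterT => chi' _ c hcm; case: nc; exists c.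
    apply: filterS (ptws_nbhs_eval chi (Jideal c)) => chi' /= E d hdm.
    by have <- : c = d by apply: hinj; rewrite ?inE// hcm.
  elim: n => [|n IHn].
    by apply: filterS (agree1 0) => chi' E c; rewrite leqn0 => /eqP; exact: E.
  apply: filterS2 IHn (agree1 n.+1) => chi' E1 E2 c.
  by rewrite leq_eqVlt => /predU1P[/E2|/E1].
have /choice[F FP] : forall n, exists F, Y F /\
    forall c, h c <= n -> F c <-> filter_of chi c.
  move=> n; have [_ [[F YF <-] E]] := clchi _ (nbhs_agree n).
  by exists F; split=> // c /E EF; rewrite -(char_of_Jideal c (fY _ YF)) EF.
rewrite -(filter_ofK C_lcancel C_aligned Ochi); exists (filter_of chi) => //.
apply: (Ylim F) (filter_filter_of C_lcancel C_aligned Ochi) _ => [n|c]; first exact: (FP n).1.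
by near=> n; apply: (FP n).2; near: n; exact: nbhs_infty_ge.
Unshelve. all: by end_near.
Qed.

Lemma closed_invariant_chars_of Y : countable [set: C] -> left_cancellative C ->
  finitely_aligned C -> closed_invariant_filters Y -> closed_invariant (chars_of Y).
Proof.
move=> C_countable C_lcancel C_aligned cY; have [fY Ylact Ycut _] := cY; split.
- by move=> _ [F YF <-]; apply: Omega_char_of; exact: fY.
- exact: closed_chars_of.
- exact: act_invariant_chars_of.
Qed.

Lemma filters_in_closed_invariant X : left_cancellative C ->
  finitely_aligned C -> closed_invariant X -> closed_invariant_filters (filters_in X).
Proof.
move=> C_lcancel C_aligned [XO clX Xact].
split=> [F []//|F c [fF XF] Fc|F c [fF XF] Fc|u F uX fF uF].
- split; first exact: filter_lact.
  by rewrite -act_translation; apply: Xact => //; apply/char_of_translation.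
- split; first exact: filter_cut.
  by rewrite -act_cotranslation; apply: Xact => //; apply/char_of_cotranslation.
- split=> //.
  (* Each e is a finite union of principal ideals, so the value at e depends on finitely many
     memberships and is eventually constant. *)
  have ucvg : (char_of \o u) @ \oo --> char_of F.
    apply: ptws_cvg => e.
    have [A /finite_range[m [g ->]] eE] :=
      constructible_finitely_generated C_lcancel C_aligned (svalP e).
    have charP G : is_filter G -> char_of G e <-> exists i, G (g i).
      move=> [_ Gle _]; rewrite char_ofP eE; split=> [[c Gc [_ [i _ <-] gic]]|[i Gi]].
        by exists i; exact: Gle gic Gc.
      by exists (g i) => //; exists (g i); [exists i | exact: prec_refl].
    near=> n.
    have uFg : forall i, u n (g i) <-> F (g i).
      by near: n; apply: filter_forall => i; exact: uF.
    apply/idP/idP => [/(charP _ (uX n).1)[i ugi]|/(charP _ fF)[i Fgi]].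
      by apply/(charP _ fF); exists i; apply/uFg.
    by apply/(charP _ (uX n).1); exists i; apply/uFg.
  have [V clV VX] := (closed_subspaceP _ _).1 clX.
  have VXF : V `&` @Omega C = X by rewrite VX; apply/setIidPl.
  suff : (V `&` @Omega C) (char_of F) by rewrite VXF.
  split; last exact: Omega_char_of.
  apply: (closed_cvg V clV _ _ ucvg).
  by near=> n; have : X (char_of (u n)) by [exact: (uX n).2]; rewrite -VXF => -[].
Unshelve. all: by end_near.
Qed.

Lemma filters_inK X : left_cancellative C -> finitely_aligned C ->
  X `<=` @Omega C -> chars_of (filters_in X) = X.
Proof.
move=> C_lcancel C_aligned XO; apply/seteqP; split=> [_ [F [_ XF] <-]//|chi Xchi].
have Ochi := XO _ Xchi.
exists (filter_of chi); last exact: filter_ofK.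
by split; [exact: filter_filter_of | rewrite filter_ofK].
Qed.

Lemma chars_ofK Y : (forall F, Y F -> is_filter F) -> filters_in (chars_of Y) = Y.
Proof.
move=> fY; apply/seteqP; split=> [F [fF [G YG GF]]|F YF].
  by rewrite -(char_ofK fF) -GF char_ofK //; exact: fY.
by split; [exact: fY | exists F].
Qed.

End UnitSpace.

(** * The bijection between closed invariant subspaces and pairs *)

Theorem theorem2 (C : smallCategory) (S : set C)
  (C_countable : countable [set: C])
  (C_lcancel : left_cancellative C)
  (C_aligned : finitely_aligned C)
  (S_garside : garside_family S)
  (S_nonunit : S `&` @units C = set0)
  (S_transverse : eqstar_transverse S)
  (S_bounded : locally_bounded S) :
  exists f : set {ptws J C -> bool} -> set C * set C,
    set_bij (@closed_invariant C) (garside_pair S) f.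
Proof.
(* Here [chars_of] inverts [filters_in] and [filters_of_pair] inverts [pair_of_filters], each on
   both sides, which gives injectivity and surjectivity. *)
exists (pair_of_filters S \o @filters_in C); split.
- move=> X cX; apply: garside_pair_of_filters => //.
  exact: filters_in_closed_invariant.
- move=> X X' /set_mem cX /set_mem cX' /= E.
  have [XO _ _] := cX; have [X'O _ _] := cX'.
  rewrite -(filters_inK C_lcancel C_aligned XO) -(filters_inK C_lcancel C_aligned X'O).
  rewrite -(pair_of_filtersK C_lcancel S_garside S_nonunit S_bounded C_countable
    (filters_in_closed_invariant C_lcancel C_aligned cX)) E.
  by rewrite pair_of_filtersK //; exact: filters_in_closed_invariant.
- move=> TD gTD; have cY := closed_invariant_filters_of_pair C_lcancel S_garside
    S_nonunit S_bounded gTD.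
  exists (chars_of (filters_of_pair S TD)); first exact: closed_invariant_chars_of.
  by rewrite /= chars_ofK ?filters_of_pairK //; case: cY.
Qed.
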